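(* There exists $p\in\omega^*=\beta\omega\setminus\omega$ for which the following conditions hold: (1) the space $\omega^*\setminus\{p\}$ is $ccc$-bounded; (2) $P(\omega^*\setminus\{p\})$ is $\omega$-bounded and $P(\omega^*\setminus\{p\})=P_\beta(\omega^*\setminus\{p\})$; (3) $P(\beta\omega\setminus\{p\})$ is totally countably compact.
   Context: $\beta\omega$ is the Stone–Čech compactification of the discrete countable space $\omega$. A space has countable Suslin number if every disjoint family of its open sets is at most countable. A space $Z$ is $ccc$-bounded if the closure $\overline M$ in $Z$ is compact for every subset $M\subset Z$ which (as a subspace) has countable Suslin number. A space is $\omega$-bounded if the closure of every countable subset is compact. A space $Z$ is totally countably compact if for every infinite $L\subset Z$ there exists a countable (i.e. countably infinite) $M\subset L$ such that $\overline M$ is compact. $P(X)$ is the set of Radon probability measures on the Borel $\sigma$-algebra of $X$ with the weak topology, i.e. the topology generated by the functions $\mu\mapsto\int_X f\,d\mu$ for bounded continuous $f:X\to\mathbb R$. $P_\beta(X)$ is the set of $\mu\in P(X)$ with $\mu(K)=1$ for some compact $K\subset X$. *)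

(* Defs.v *)
From HB Require Import structures.
From mathcomp Require Import all_boot all_order all_algebra.
From mathcomp Require Import all_classical all_reals all_analysis.
Import Order.TTheory GRing.Theory Num.Theory.
Import numFieldNormedType.Exports.

Set Implicit Arguments.
Unset Strict Implicit.
Unset Printing Implicit Defensive.

Local Open Scope classical_set_scope.
Local Open Scope ring_scope.

(** Points are the ultrafilters on [nat]; [stone_set A] is the basic clopen set
    of the ultrafilters containing [A].  The lemmas [beta_omega_compact],
    [beta_omega_hausdorff], [open_principal], [dense_principal] and
    [beta_omega_extend] show that this space, with [principal], is the
    Stone-Cech compactification of the discrete space [nat]. *)
Definition beta_omega : Type := {F : set_system nat | UltraFilter F}.

HB.instance Definition _ := gen_eqMixin beta_omega.
HB.instance Definition _ := gen_choiceMixin beta_omega.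

Definition principal (n : nat) : beta_omega :=
  exist _ (principal_filter n) (principal_filter_ultra n).

HB.instance Definition _ := isPointed.Build beta_omega (principal 0%N).

Definition stone_set (A : set nat) : set beta_omega :=
  [set u | proj1_sig u A].

Lemma stone_set_principal A n : stone_set A (principal n) <-> A n.
Proof. exact: principal_filterP. Qed.

Lemma stone_setT : stone_set setT = setT.
Proof.
apply/seteqP; split=> // -[F FU] _; rewrite /stone_set/=; exact: filterT.
Qed.

Lemma stone_setI A B : stone_set (A `&` B) = stone_set A `&` stone_set B.
Proof.
apply/seteqP; split=> -[F FU]; rewrite /stone_set/=.
  by move=> FAB; split; apply: filterS FAB => x [].
by move=> [FA FB]; apply: filterI.
Qed.

Lemma proper_filterC T (F : set_system T) (A : set T) :
  ProperFilter F -> F A -> ~ F (~` A).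
Proof.
by move=> FF FA FCA; have [x [Ax nAx]] := filter_ex (filterI FA FCA); exact: nAx.
Qed.

Lemma stone_setC A : stone_set (~` A) = ~` stone_set A.
Proof.
apply/seteqP; split=> -[F FU]; rewrite /stone_set/=.
  by move=> FCA FA; apply: proper_filterC FA FCA; exact: ultra_proper.
by move=> nFA; have [//|] := in_ultra_setVsetC A FU.
Qed.

Lemma stone_set0 : stone_set set0 = set0.
Proof. by rewrite -setCT stone_setC stone_setT setCT. Qed.

Lemma stone_set_cover : \bigcup_(A in [set: set nat]) stone_set A = setT.
Proof. by apply/seteqP; split=> // u _; exists setT; rewrite ?stone_setT. Qed.

Lemma stone_set_join (A B : set nat) (u : beta_omega) :
  [set: set nat] A -> [set: set nat] B -> stone_set A u -> stone_set B u ->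
  exists C, [/\ [set: set nat] C, stone_set C u &
                stone_set C `<=` stone_set A `&` stone_set B].
Proof. by move=> _ _ uA uB; exists (A `&` B); rewrite stone_setI; split. Qed.

HB.instance Definition _ :=
  isBaseTopological.Build beta_omega stone_set_cover stone_set_join.

Lemma open_stone_set A : open (stone_set A).
Proof. by exists [set A] => //; rewrite bigcup_set1. Qed.

Lemma nbhs_beta_omegaP (u : beta_omega) (V : set beta_omega) :
  nbhs u V <-> exists2 A, stone_set A u & stone_set A `<=` V.
Proof.
split=> [|[A uA AV]].
  rewrite nbhsE => -[W [[D _ <-] [A DA uA]] WV]; exists A => // v vA.
  by apply: WV; exists A.
apply: (filterS AV); apply: open_nbhs_nbhs; split=> //; exact: open_stone_set.
Qed.

Lemma beta_omega_eq (u v : beta_omega) :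
  (forall A, stone_set A u -> stone_set A v) -> u = v.
Proof.
case: u v => [F FU] [G GU] FG; apply: eq_exist.
by apply: esym; apply: (@max_filter _ _ FU) => //; exact: ultra_proper.
Qed.

Lemma ultra_of_dichotomy T (F : set_system T) :
  ProperFilter F -> (forall A, F A \/ F (~` A)) -> UltraFilter F.
Proof.
move=> FF FAC; split=> // G GF FG; apply/seteqP; split=> // A GA.
by have [//|/FG /(proper_filterC GF GA)] := FAC A.
Qed.

Lemma beta_omega_hausdorff : hausdorff_space beta_omega.
Proof.
move=> u v uv; apply: beta_omega_eq => A uA; apply: contrapT => vA.
have nA : nbhs u (stone_set A) by apply/nbhs_beta_omegaP; exists A.
have nCA : nbhs v (stone_set (~` A)).
  by apply/nbhs_beta_omegaP; exists (~` A); rewrite // stone_setC.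
by have [w [wA]] := uv _ _ nA nCA; rewrite stone_setC; apply.
Qed.

Lemma beta_omega_compact : compact [set: beta_omega].
Proof.
rewrite compact_ultra => U UU _.
pose F : set_system nat := [set A | U (stone_set A)].
have FF : ProperFilter F.
  split; first by rewrite /F /= stone_set0; exact: filter_not_empty.
  split; rewrite /F /=.
  - by rewrite /= stone_setT; exact: filterT.
  - by move=> A B UA UB; rewrite /= stone_setI; exact: filterI.
  - move=> A B AB; apply: filterS => -[G GU]; exact: filterS.
have FU : UltraFilter F.
  apply: ultra_of_dichotomy => A; rewrite /F /= stone_setC.
  exact: in_ultra_setVsetC.
exists (exist _ F FU); split=> // V /nbhs_beta_omegaP[A FA AV].
exact: filterS AV FA.
Qed.

Lemma stone_set1 n : stone_set [set n] = [set principal n].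
Proof.
apply/seteqP; split=> [u un|_ ->]; last by [].
apply/esym/beta_omega_eq => A /stone_set_principal An.
by case: u un => F FU /= Fn; apply: filterS Fn => _ ->.
Qed.

Lemma principal_inj : injective principal.
Proof.
move=> m n mn; have : stone_set [set n] (principal n) by [].
by rewrite -mn; exact.
Qed.

Lemma open_principal n : open [set principal n].
Proof. by rewrite -stone_set1; exact: open_stone_set. Qed.

Lemma dense_principal : dense (range principal).
Proof.
move=> O [u Ou] oO; have /nbhs_beta_omegaP[A uA AO] : nbhs u O.
  exact: open_nbhs_nbhs (conj oO Ou).
have [n An] : A !=set0.
  case: u {Ou} uA => F FU FA.
  have FP : ProperFilter F by exact: ultra_proper.
  exact: filter_ex FA.
by exists (principal n); split; [exact/AO/stone_set_principal|exists n].
Qed.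

Lemma beta_omega_extend (K : topologicalType) (f : nat -> K) :
  hausdorff_space K -> compact [set: K] ->
  exists2 g : beta_omega -> K, continuous g & forall n, g (principal n) = f n.
Proof.
move=> hK cK.
have lim_ex (u : beta_omega) : exists y : K, f @ proj1_sig u --> y.
  case: u => F FU /=.
  have FP : ProperFilter F by exact: ultra_proper.
  have : UltraFilter (f @ F).
    apply: ultra_of_dichotomy => A; exact: (in_ultra_setVsetC (f @^-1` A) FU).
  move=> fFU; move: cK; rewrite compact_ultra => /(_ _ fFU filterT)[y [_ fy]].
  by exists y.
pose g u := sval (cid (lim_ex u)).
have gP u : f @ proj1_sig u --> g u by exact: svalP (cid (lim_ex u)).
exists g => [u V Vgu|n]; last first.
  have := gP (principal n) => fn; apply/esym/(close_eq hK) => A nA B nB.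
  exists (f n); split; last exact: nbhs_singleton nB.
  by have /principal_filterP := fn _ (open_nbhs_nbhs nA).
have := @compact_regular _ (g u) _ hK cK filterT _ Vgu.
move=> [W nW WV]; apply/nbhs_beta_omegaP; exists (f @^-1` W).
  exact: (gP u).
move=> v vW /=; apply: WV => B nB.
case: v vW nB => F FU /= FW /(gP (exist _ F FU)) /= FB.
have FP : ProperFilter F by exact: ultra_proper.
have [n [Wn Bn]] := filter_ex (filterI FW (FB : F (f @^-1` B))).
by exists (f n).
Qed.

Definition omega_star : set beta_omega := ~` range principal.

Lemma omega_star_infinite (A : set nat) :
  infinite_set A -> exists2 u, omega_star u & stone_set A u.
Proof.
move=> Ainf; pose F : set_system nat := [set B | finite_set (A `\` B)].
have FF : ProperFilter F.
  split; first by rewrite /F /= setD0.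
  split; rewrite /F /=.
  - by rewrite setDT.
  - by move=> B C FB FC; rewrite /= setDIr finite_setU.
  - by move=> B C BC; apply: sub_finite_set; exact: setDS.
have [G [GU FG]] := ultraFilterLemma FF.
exists (exist _ G GU); last first.
  by apply: FG; rewrite /F /= setDv.
move=> [n _ nG].
have : stone_set (~` [set n]) (exist _ G GU).
  apply: FG; rewrite /F /= setDE setCK.
  exact: sub_finite_set (@subIsetr _ A [set n]) (finite_set1 n).
by rewrite -nG stone_setC; apply.
Qed.

Lemma omega_star_punctured_nonempty (p : beta_omega) :
  (omega_star `\ p) !=set0.
Proof.
have inf_range (h : nat -> nat) : injective h -> infinite_set (range h).
  by move=> hI; rewrite (eq_finite_set (inj_card_eq (in2W hI))); exact: infinite_nat.
have [|u su uE] := @omega_star_infinite (range (fun n => n.*2)).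
  by apply: inf_range; exact: double_inj.
have [|v sv vO] := @omega_star_infinite (range (fun n => n.*2.+1)).
  by apply: inf_range => m n [] /double_inj.
have [up|up] := pselect (u = p); last by exists u.
exists v; split=> // vp; move: vO; rewrite vp -up => uO.
case: u {su up} uE uO => F FU /= FE FO.
have [n [[i _ <-] [j _]]] := filter_ex (filterI FE FO).
by move=> /(congr1 odd) /=; rewrite !odd_double.
Qed.

Lemma beta_omega_punctured_nonempty (p : beta_omega) : [set~ p] !=set0.
Proof.
by have [u [_ up]] := omega_star_punctured_nonempty p; exists u.
Qed.

(** The punctured spaces, with the topology induced by [beta_omega]; the
    distinguished points are there only because the library's measurable types
    are pointed. *)
Definition omega_star_minus (p : beta_omega) : Type :=
  set_type (omega_star `\ p).

HB.instance Definition _ p :=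
  Topological.copy (omega_star_minus p) (set_type (omega_star `\ p)).
HB.instance Definition _ p := isPointed.Build (omega_star_minus p)
  (SigSub (mem_set (svalP (cid (omega_star_punctured_nonempty p))))).

Definition beta_omega_minus (p : beta_omega) : Type := set_type [set~ p].

HB.instance Definition _ p :=
  Topological.copy (beta_omega_minus p) (set_type [set~ p]).
HB.instance Definition _ p := isPointed.Build (beta_omega_minus p)
  (SigSub (mem_set (svalP (cid (beta_omega_punctured_nonempty p))))).

Lemma set_type_hausdorff (X : topologicalType) (A : set X) :
  hausdorff_space X -> hausdorff_space (set_type A).
Proof.
move=> hX x y xy; apply: val_inj; apply: hX => U V nU nV.
have [z [Uz Vz]] := xy _ _ (initial_continuous nU) (initial_continuous nV).
by exists (set_val z).
Qed.

Lemma omega_star_minus_hausdorff p : hausdorff_space (omega_star_minus p).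
Proof. exact: set_type_hausdorff beta_omega_hausdorff. Qed.

Lemma beta_omega_minus_hausdorff p : hausdorff_space (beta_omega_minus p).
Proof. exact: set_type_hausdorff beta_omega_hausdorff. Qed.

Definition countable_suslin (X : topologicalType) : Prop :=
  forall G : set (set X),
    (forall U, G U -> open U) -> trivIset G id -> countable G.

Definition ccc_bounded (Z : topologicalType) : Prop :=
  forall M : set Z, countable_suslin (set_type M) -> compact (closure M).

Definition omega_bounded (Z : topologicalType) : Prop :=
  forall M : set Z, countable M -> compact (closure M).

Definition totally_countably_compact (Z : topologicalType) : Prop :=
  forall L : set Z, infinite_set L ->
    exists M : set Z,
      [/\ M `<=` L, infinite_set M, countable M & compact (closure M)].

Definition borel (X : ptopologicalType) : measurableType _ :=
  g_sigma_algebraType (@open X).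

(** Meant for Hausdorff [X], where compact sets are Borel. *)
Definition radon (R : realType) (X : ptopologicalType)
    (mu : probability (borel X) R) : Prop :=
  forall B : set (borel X), measurable B -> forall e : R, 0 < e ->
    exists K : set X,
      [/\ compact K, K `<=` B & (mu (B `\` K) < e%:E)%E].

(** A library measure is a function on all subsets, with arbitrary values on
    the non-measurable ones.  Fixing those values to be 0 makes the elements
    of this type correspond to the measures on the Borel sigma-algebra, see
    [radon_probability_eq]. *)
Definition radon_probability (R : realType) (X : ptopologicalType) : Type :=
  set_type [set mu : probability (borel X) R |
    radon mu /\ forall A, ~ measurable A -> mu A = 0%E].

HB.instance Definition _ (R : realType) (X : ptopologicalType) :=
  Choice.on (radon_probability R X).

Definition measure_of (R : realType) (X : ptopologicalType)
    (mu : radon_probability R X) : probability (borel X) R := set_val mu.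

Lemma eq_probability d (T : measurableType d) (R : realType)
    (P Q : probability T R) : P = Q :> (set T -> \bar R) -> P = Q.
Proof.
destruct P as [P [p1 p2 p3 p4 p5 p6 p7]], Q as [Q [q1 q2 q3 q4 q5 q6 q7]] => /= E.
subst Q.
have E1 : p1 = q1 by destruct p1, q1; f_equal; exact: Prop_irrelevance.
subst q1.
have E2 : p2 = q2 by destruct p2, q2; f_equal; exact: Prop_irrelevance.
have E3 : p3 = q3 by destruct p3, q3; f_equal; exact: Prop_irrelevance.
have E4 : p4 = q4 by destruct p4, q4; f_equal; exact: Prop_irrelevance.
have E5 : p5 = q5 by destruct p5, q5; f_equal; exact: Prop_irrelevance.
have E6 : p6 = q6 by destruct p6, q6; f_equal; exact: Prop_irrelevance.
have E7 : p7 = q7 by destruct p7, q7; f_equal; exact: Prop_irrelevance.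
by subst.
Qed.

Lemma radon_probability_eq (R : realType) (X : ptopologicalType)
    (mu nu : radon_probability R X) :
  (forall A, measurable A -> measure_of mu A = measure_of nu A) -> mu = nu.
Proof.
move=> mn; apply: val_inj => /=.
have E : (set_val mu : probability (borel X) R) = set_val nu :> (set _ -> _).
  apply/funext => A; have [/mn//|nA] := pselect (measurable A).
  have [_ mu0] := set_mem (svalP mu); have [_ nu0] := set_mem (svalP nu).
  by rewrite mu0// nu0.
exact: eq_probability E.
Qed.

Definition bounded_continuous (R : realType) (X : ptopologicalType) : Type :=
  {f : X -> R | continuous f /\ bounded_fun f}.

Definition integral_against (R : realType) (X : ptopologicalType)
    (f : bounded_continuous R X) (mu : radon_probability R X) : R :=
  Rintegral (measure_of mu) setT (proj1_sig f).

HB.instance Definition _ (R : realType) (X : ptopologicalType) :=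
  Topological.copy (radon_probability R X)
    (sup_topology (fun f : bounded_continuous R X =>
       Topological.on (initial_topology (integral_against f)))).

Definition prob_space (R : realType) (X : ptopologicalType) : topologicalType :=
  radon_probability R X.

Definition prob_space_beta (R : realType) (X : ptopologicalType) :
    set (prob_space R X) :=
  [set mu : radon_probability R X |
    exists K : set X, compact K /\ measure_of mu K = 1%E].
Arguments prob_space_beta : clear implicits.

(* Main.v *)
Require Import Defs.
From HB Require Import structures.
From mathcomp Require Import all_boot all_order all_algebra.
From mathcomp Require Import all_classical all_reals all_analysis.
From mathcomp Require Import measurable_realfun finmap ring lra.
From mathcomp Require wochoice.
Import Order.TTheory GRing.Theory Num.Theory.
Import numFieldNormedType.Exports.

(** Kunen's transfinite construction, along a well-order of the power set of
    [nat] whose segments are too small to map onto it, refines a family of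
    sets while preserving the independence of all but few columns of a linked
    matrix, and gives an OK point [p] of [omega^*]: to every sequence [U_n] in
    [p] correspond uncountably many members of [p] of which any [n] have
    intersection almost contained in [U_n].  Such a point is not in the closure
    of a ccc subset [M] of [omega^* \ {p}]: a maximal disjoint family of open
    subsets of [M] whose closures avoid [p] is a sequence [B_n], and if [U_n]
    is disjoint from [B_0, ..., B_(n-1)], each member attached to [U] meets some
    [B_n], which makes uncountably many of them meet the same [B_n], while no
    point of [B_n] is in more than [n] of them.

    The supports of countably many Radon measures form a ccc set, so their
    closure avoids [p].  On a space with a base of compact open sets, a
    uniformly tight set of measures has compact closure: the limit along an
    ultrafilter is a content on the compact open sets, which extends to a Radon
    measure, and continuous functions are close to step functions outside of a
    set of small mass.  For sequences of measures on [beta_omega \ {p}] the mass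
    sitting on [nat] is made uniformly small near [p] by a gliding hump
    argument. *)

Set Implicit Arguments.
Unset Strict Implicit.
Unset Printing Implicit Defensive.
Local Open Scope classical_set_scope.

(** * Kunen's OK points *)

Definition trace (k : nat) (X : set nat) : {ffun 'I_k -> bool} :=
  [ffun i : 'I_k => (i : nat) \in X].

Lemma trace_neq (X Y : set nat) : X != Y ->
  exists k0, forall k, (k0 <= k)%N -> trace k X != trace k Y.
Proof.
move=> XY; have [n nXY] : exists n, (n \in X) != (n \in Y).
  apply: contrapT => /forallNP nXY; move/eqP: XY; apply; apply/seteqP.
  have E n : (n \in X) = (n \in Y) by apply/eqP/negPn/negP; exact: nXY.
  by split=> n /mem_set; [rewrite E|rewrite -E] => /set_mem.
exists n.+1 => k nk; apply: contra nXY => /eqP/ffunP/(_ (Ordinal nk)).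
by rewrite !ffunE /= => ->.
Qed.

Lemma trace_notin (X : set nat) (s : seq (set nat)) : X \notin s ->
  exists k0, forall k, (k0 <= k)%N -> trace k X \notin map (trace k) s.
Proof.
elim: s => [|Y s IH]; first by exists 0%N.
rewrite in_cons negb_or => /andP[/trace_neq[k1 k1P] /IH[k2 k2P]].
exists (maxn k1 k2) => k; rewrite geq_max => /andP[/k1P Xk /k2P Ys].
by rewrite /= in_cons negb_or Xk.
Qed.

Lemma trace_uniq (s : seq (set nat)) : uniq s ->
  exists k0, forall k, (k0 <= k)%N -> uniq (map (trace k) s).
Proof.
elim: s => [|Y s IH]; first by exists 0%N.
move=> /= /andP[/trace_notin[k1 k1P] /IH[k2 k2P]].
by exists (maxn k1 k2) => k; rewrite geq_max => /andP[/k1P -> /k2P ->].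
Qed.

(* Kunen's linked matrix consists of sets of pairs [(k, f)], where [f] assigns to
   the trace on [k] of [Y] a family of at most [n] subsets of [k] containing the
   trace of [X]; distinct [X] and [Y] are told apart by their traces on large
   [k]. *)
Definition approx : Type :=
  {k : nat & {ffun {ffun 'I_k -> bool} -> {set {ffun 'I_k -> bool}}}}.

HB.instance Definition _ := Countable.on approx.

Definition Approx (k : nat)
    (f : {ffun {ffun 'I_k -> bool} -> {set {ffun 'I_k -> bool}}}) : approx :=
  existT _ k f.

Definition link (Y : set nat) (n : nat) (X : set nat) : set approx :=
  [set s : approx | (#|projT2 s (trace (projT1 s) Y)| <= n)%N &&
           (trace (projT1 s) X \in projT2 s (trace (projT1 s) Y))].

(** Once [k] is so large that the members of [s] have distinct traces, a pair [(k, f)] in all the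
    links would need more than [n] traces in a family of at most [n]. Only finitely many pairs have
    a smaller [k]. *)
Lemma link_finite Y n (s : seq (set nat)) : uniq s -> (n < size s)%N ->
  finite_set [set a | forall X, X \in s -> link Y n X a].
Proof.
move=> us ns; have [k0 k0P] := trace_uniq us.
have : finite_set (\bigcup_(k in `I_k0)
    range (@Approx k)).
  apply: bigcup_finite => // k _; exact: finite_image.
apply: sub_finite_set => -[k f] /= H.
have [kk0|k0k] := ltnP k k0; first by exists k => //; exists f.
have us' := k0P _ k0k.
case: s us ns us' H {k0P} => // X0 s us ns us' H.
have /andP[card_f _] := H X0 (mem_head _ _).
have : (size (map (trace k) (X0 :: s)) <= #|f (trace k Y)|)%N.
  rewrite cardE; apply: uniq_leq_size us' _ => _ /mapP[X Xs ->].
  by rewrite mem_enum; have /andP[] := H X Xs.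
by rewrite size_map => /leq_trans/(_ card_f); rewrite leqNgt ns.
Qed.

Definition link_cond (c : seq (set nat * seq (set nat))) : set approx :=
  [set a | forall e, e \in c -> forall X, X \in e.2 ->
    link e.1 (size e.2) X a].

Lemma link_independent (c : seq (set nat * seq (set nat))) :
  uniq (unzip1 c) -> exists k0, forall k, (k0 <= k)%N ->
  exists f, link_cond c (@Approx k f).
Proof.
move=> uc; have [k0 k0P] := trace_uniq uc.
exists k0 => k /k0P; rewrite /unzip1 -map_comp => uk.
pose t (e : set nat * seq (set nat)) := trace k e.1.
(* The traces of the columns are distinct at stage [k], so the value at each of them can be
   prescribed separately. When [y] is the trace of no column, [index] runs past the end and the
   default gives the empty list. *)
pose F (y : {ffun 'I_k -> bool}) :=
  map (trace k) (nth (set0, [::]) c (index y (map t c))).2.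
exists [ffun y => [set z in F y]%SET] => e ec X Xe /=.
have FE : F (trace k e.1) = map (trace k) e.2.
  have /(nthP (set0, [::]))[i ic ie] := ec.
  have -> : trace k e.1 = nth (t (set0, [::])) (map t c) i.
    by rewrite (nth_map (set0, [::])) // ie.
  by rewrite /F index_uniq ?size_map // ie.
rewrite /link /= !ffunE FE; apply/andP; split.
  by rewrite cardsE (leq_trans (card_size _)) // size_map.
by rewrite inE map_f.
Qed.

(** The linked matrix, carried over to [nat] by the countability of [approx]. *)
Definition linked (Y : set nat) (n : nat) (X : set nat) : set nat :=
  choice.pickle @` link Y n X.

(* A condition chooses, for finitely many columns [Y], a list of sets [X]; the
   length of this list is the level [n] at which they are linked. *)
Definition cond (c : seq (set nat * seq (set nat))) : set nat :=
  [set k | forall e, e \in c -> forall X, X \in e.2 ->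
    linked e.1 (size e.2) X k].

Lemma linkedW Y m n X : (m <= n)%N -> linked Y m X `<=` linked Y n X.
Proof.
move=> mn _ [[k f] /andP[fm fX] <-]; exists (Approx f) => //.
by apply/andP; split=> //; exact: leq_trans mn.
Qed.

Lemma linked_finite Y n (s : seq (set nat)) : uniq s -> (n < size s)%N ->
  finite_set [set k | forall X, X \in s -> linked Y n X k].
Proof.
move=> us ns; apply: (sub_finite_set _ (finite_image choice.pickle (link_finite Y us ns))).
case: s us ns => // X0 s us ns k kP.
have [a _ ak] := kP X0 (mem_head _ _); exists a => // X /kP[b Xb bk].
by rewrite (_ : a = b) //; apply: (pcan_inj choice.pickleK); rewrite ak bk.
Qed.

Lemma unbounded_infinite (A : set nat) :
  (forall k0, exists2 k, (k0 <= k)%N & A k) -> infinite_set A.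
Proof.
move=> uA /finite_seqP[s sE]; have [k] := uA (\max_(i <- s) i).+1.
by rewrite sE /= => kmax /(@leq_bigmax_seq _ s xpredT id)/(_ isT); rewrite leqNgt kmax.
Qed.

Lemma cond_infinite (c : seq (set nat * seq (set nat))) :
  uniq (unzip1 c) -> infinite_set (cond c).
Proof.
move=> /link_independent[k0 k0P] fc.
(* [stage] reads [k] off the code of [(k, f)]. Its values on [cond c] are unbounded, which a finite
   set does not allow. *)
pose stage n := if choice.unpickle n is Some a then tag (a : approx) else 0%N.
have /unbounded_infinite : forall k1, exists2 k, (k1 <= k)%N & (stage @` cond c) k.
  move=> k1; exists (maxn k0 k1); first exact: leq_maxr.
  have [f fc'] := k0P _ (leq_maxl k0 k1).
  exists (choice.pickle (Approx f)); last by rewrite /stage choice.pickleK.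
  by move=> e ec X Xe; exists (Approx f) => //; exact: fc'.
by apply; exact: finite_image.
Qed.

Definition meet (g : seq (set nat)) : set nat :=
  [set k | forall G, G \in g -> G k].

(* [K] is the set of the columns already used up. *)
Definition independent (G : set (set nat)) (K : set (set nat)) : Prop :=
  forall g, (forall X, X \in g -> G X) ->
  forall c, uniq (unzip1 c) -> (forall j, j \in unzip1 c -> ~ K j) ->
  infinite_set (meet g `&` cond c).

Lemma independent0 : independent set0 set0.
Proof.
move=> g g0 c uc _; apply: sub_infinite_set (cond_infinite uc) => k ck.
by split=> // X /g0.
Qed.

(* A sequence in a nonprincipal ultrafilter can be shrunk to a vanishing one. *)
Definition vanishing (C : nat -> set nat) : Prop :=
  (forall n, C n.+1 `<=` C n) /\ forall k, exists n, ~ C n k.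

Lemma vanishingW C m n : vanishing C -> (m <= n)%N -> C n `<=` C m.
Proof.
move=> [dC _]; elim: n => [|n IH]; first by rewrite leqn0 => /eqP ->.
by rewrite leq_eqVlt => /orP[/eqP ->//|]; rewrite ltnS => /IH; exact: subset_trans.
Qed.

(** In the first case no filter containing [F] contains all the [C n], so the OK condition for [C]
    is void; in the second, [F] contains a refinement that witnesses it. *)
Definition handled (C : nat -> set nat) (F : set (set nat)) : Prop :=
  (exists n, F (~` C n)) \/
  exists D : set nat -> set nat, (forall i, F (D i)) /\
    forall s, uniq s -> s != [::] ->
      finite_set (meet (map D s) `\` C (size s)).

Lemma unzip1_cat (T U : Type) (c c' : seq (T * U)) :
  unzip1 (c ++ c') = unzip1 c ++ unzip1 c'.
Proof. exact: map_cat. Qed.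

Lemma independent_setC (G K : set (set nat)) (C : set nat) g c :
  independent G K ->
  (forall X, X \in g -> G X) -> uniq (unzip1 c) ->
  (forall j, j \in unzip1 c -> ~ K j) ->
  finite_set (meet g `&` cond c `&` C) ->
  independent (G `|` [set ~` C]) (K `|` [set` unzip1 c]).
Proof.
move=> GK gG uc cK fin g' g'G c' uc' c'K finc'.
have := GK (g ++ [seq X <- g' | X != ~` C]) _ (c ++ c') _ _.
apply.
- move=> X; rewrite mem_cat mem_filter => /orP[/gG//|/andP[XC /g'G[//|/= XE]]].
  by rewrite XE eqxx in XC.
- rewrite unzip1_cat cat_uniq uc uc' andbT; apply/hasPn => j /c'K /= jK.
  by apply/negP => jc; apply: jK; right.
- by move=> j; rewrite unzip1_cat mem_cat => /orP[/cK//|/c'K jK jK']; apply: jK; left.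
have finU : finite_set ((meet g `&` cond c `&` C) `|` (meet g' `&` cond c')).
  by rewrite finite_setU.
apply: sub_finite_set finU => k [gk ck].
have [Ck|nCk] := pselect (C k); [left|right].
  by split=> //; split=> [X Xg|e ec]; [apply: gk|apply: ck]; rewrite mem_cat ?Xg ?ec.
split=> [X Xg|e ec]; last by apply: ck; rewrite mem_cat ec orbT.
have [->//|XC] := eqVneq X (~` C).
by apply: gk; rewrite mem_cat mem_filter XC Xg orbT.
Qed.

(** On the layer between [C n] and [C n.+1], row [i] of column [j] at level [n]: the level grows
    along the layers. *)
Definition spread (j : set nat) (C : nat -> set nat) (i : set nat) : set nat :=
  [set k | exists n, [/\ linked j n i k, C n k & ~ C n.+1 k]].

(** A point outside [C (size s)] is in a layer of index [m < size s], where lying in all the spread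
    sets means being linked at level [m] to more than [m] rows. *)
Lemma spread_finite j C s : vanishing C -> uniq s -> s != [::] ->
  finite_set (meet (map (spread j C) s) `\` C (size s)).
Proof.
move=> vC us s0.
have : finite_set (\bigcup_(m in `I_(size s))
    [set k | forall X, X \in s -> linked j m X k]).
  by apply: bigcup_finite => // m ms; exact: linked_finite.
apply: sub_finite_set => k [sk nCk].
case: s s0 us sk nCk => // X0 s _ us sk nCk.
have /sk[m [lm Cm nCm]] : spread j C X0 \in map (spread j C) (X0 :: s) by exact: mem_head.
exists m => /=.
  by rewrite ltnNge; apply/negP => le; apply: nCk; exact: vanishingW Cm.
move=> X Xs; have /sk[m' [lm' Cm' nCm']] := map_f (spread j C) Xs.
suff <- : m' = m by [].
apply/eqP; rewrite eqn_leq; apply/andP; split; rewrite leqNgt; apply/negP => lt.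
  by apply: nCm; exact: vanishingW Cm'.
by apply: nCm'; exact: vanishingW Cm.
Qed.

(** If the rows used by [g] are listed in [s], the condition [(j, s)] together with membership in
    [C (size s)] forces membership in all the spread sets of [g]. Column [j] is fresh, so this
    condition may be added. *)
Lemma independent_spread (G K : set (set nat)) C j :
  vanishing C -> independent G K -> ~ K j ->
  (forall n g c, (forall X, X \in g -> G X) -> uniq (unzip1 c) ->
     (forall j, j \in unzip1 c -> ~ K j) ->
     infinite_set (meet g `&` cond c `&` C n)) ->
  independent (G `|` range (spread j C)) (K `|` [set j]).
Proof.
move=> vC GK Kj inf g gG c uc cK.
have [s sP] : exists s, forall X, X \in g -> G X \/ X \in map (spread j C) s.
  elim: g gG => [|Y g IH] gG; first by exists [::].
  have [|s sP] := IH; first by move=> X Xg; apply: gG; rewrite in_cons Xg orbT.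
  have [GY|[i _ iY]] := gG Y (mem_head _ _).
    exists s => X; rewrite in_cons => /orP[/eqP ->|/sP//]; by left.
  exists (i :: s) => X; rewrite !in_cons => /orP[/eqP ->|/sP[?|Xs]].
  - by right; rewrite iY eqxx.
  - by left.
  - by right; rewrite Xs orbT.
pose g' := [seq X <- g | `[<G X>]].
have /inf : forall X, X \in g' -> G X.
  by move=> X; rewrite mem_filter => /andP[/asboolP].
have cK' j' : j' \in unzip1 c -> ~ K j' by move=> /cK jK jK'; apply: jK; left.
move=> /(_ (size s) ((j, s) :: c)) H fin; apply: H.
- rewrite /= uc andbT; apply/negP => /cK; apply; by right.
- by move=> j' /=; rewrite in_cons => /orP[/eqP ->//|/cK'].
apply: sub_finite_set fin => k [[gk ck] Ck].
split; last by move=> e ec; apply: ck; rewrite in_cons ec orbT.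
move=> X Xg; have [GX|/mapP[i si ->]] := sP X Xg.
  by apply: gk; rewrite mem_filter Xg andbT; apply/asboolP.
have lk := ck (j, s) (mem_head _ _) i si.
(* The first [N] with [k] outside [C N] is larger than [size s], so the layer of [k] has index at
   least [size s], and a link at level [size s] is also one at the level of the layer. *)
have exk : exists n, ~~ `[<C n k>].
  by have [n nC] := vC.2 k; exists n; apply/negP => /asboolP.
case: (ex_minnP exk) => N /asboolPn nCN minN.
have sN : (size s < N)%N.
  by rewrite ltnNge; apply/negP => le; apply: nCN; exact: vanishingW Ck.
case: N sN nCN minN => // N sN nCN minN; exists N; split=> //.
  by apply: linkedW lk.
by apply: contrapT => nC; have := minN N (introN (asboolP _) nC); rewrite ltnn.
Qed.

(* If every [C n] is compatible with all conditions, one fresh column is spread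
   over the differences of the [C n]; otherwise the columns of an incompatible
   condition are given up, which allows adding the complement of some [C n]. *)
Lemma independent_step (G K : set (set nat)) C j :
  vanishing C -> independent G K -> ~ K j ->
  exists t F, [/\ finite_set t, independent (G `|` F) (K `|` t) & handled C F].
Proof.
move=> vC GK Kj.
have [H|H] := pselect (exists n g c, [/\ forall X, X \in g -> G X, uniq (unzip1 c),
     (forall j, j \in unzip1 c -> ~ K j) &
     finite_set (meet g `&` cond c `&` C n)]).
  have [n [g [c [gG uc cK fin]]]] := H.
  exists [set` unzip1 c], [set ~` C n]; split=> //; last by left; exists n.
  exact: independent_setC GK gG uc cK fin.
exists [set j], (range (spread j C)); split => //.
  apply: independent_spread => // n g c gG uc cK fin; apply: H.
  by exists n, g, c; split.
right; exists (spread j C); split=> [i|s us s0]; first by exists i.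
exact: spread_finite.
Qed.

(** * The transfinite recursion along the power set of [nat] *)

Lemma well_founded_total_order (T : eqType) :
  exists lt : T -> T -> Prop, [/\ well_founded lt,
    forall x y z, lt x y -> lt y z -> lt x z &
    forall x y, [\/ lt x y, x = y | lt y x]].
Proof.
have [r wo] := wochoice.well_ordering_principle T.
(* Unique least elements of sets of two or three points give totality, antisymmetry and
   transitivity. *)
have minr (A : {pred T}) x : x \in A -> exists2 z, z \in A & forall y, y \in A -> r z y.
  by move=> xA; have [|z [[zA minz] _]] := wo A; [exists x|exists z].
have rtot x y : r x y \/ r y x.
  have [|z] := minr (mem [:: x; y]) x; first by rewrite !inE eqxx.
  rewrite !inE => /orP[] /eqP -> H; [left|right]; apply: H;
  by rewrite !inE eqxx ?orbT.
have rxx x : r x x by case: (rtot x x).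
have anti : antisymmetric r.
  move=> x y /andP[xy yx].
  have [|z [_ uz]] := wo (mem [:: x; y]); first by exists x; rewrite !inE eqxx.
  have zx : z = x.
    by apply: uz; split=> [|t]; rewrite !inE ?eqxx // => /orP[] /eqP ->.
  have zy : z = y.
    by apply: uz; split=> [|t]; rewrite !inE ?eqxx ?orbT // => /orP[] /eqP ->.
  by rewrite -zx zy.
have rtr x y z : r x y -> r y z -> r x z.
  move=> xy yz; have [|m] := minr (mem [:: x; y; z]) x; first by rewrite !inE eqxx.
  rewrite !inE => /or3P[] /eqP -> H.
  - by apply: H; rewrite !inE eqxx ?orbT.
  - have yx : r y x by apply: H; rewrite !inE eqxx ?orbT.
    by rewrite (anti x y) // xy yx.
  - have zy : r z y by apply: H; rewrite !inE eqxx ?orbT.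
    by rewrite -(anti y z) // yz zy.
exists (fun x y => r x y /\ x != y); split.
- apply: contrapT => nwf; have [x nx] : exists x, ~ Acc (fun x y => r x y /\ x != y) x.
    by apply: contrapT => /forallNP H; apply: nwf => x; exact: contrapT.
  have [|m] := minr [pred x | ~~ `[<Acc (fun x y => r x y /\ x != y) x>]] x.
    by rewrite inE; apply/asboolPn.
  rewrite inE => /asboolPn nm H; apply: nm; constructor => y [ym neq].
  apply: contrapT => /asboolPn ny; move: neq.
  by rewrite (anti y m) ?eqxx // ym H // inE.
- move=> x y z [xy nxy] [yz nyz]; split; first exact: rtr yz.
  apply/eqP => xz; move: nxy; rewrite (anti x y) ?eqxx // xy xz; by [].
- move=> x y; have [->|nxy] := eqVneq x y; first by constructor 2.
  by have [xy|yx] := rtot x y; [constructor 1|constructor 3]; split => //; rewrite eq_sym.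
Qed.

Definition decode (X : set nat) (n : nat) : set nat :=
  [set m | X (choice.pickle (n, m))].

Lemma decode_surj (x : nat -> set nat) : exists X, decode X = x.
Proof.
exists [set k | exists n m, k = choice.pickle (n, m) /\ x n m].
apply/funext => n; apply/seteqP; split=> m; last by exists n, m.
by move=> [n' [m' [/(pcan_inj choice.pickleK)[-> ->]]]].
Qed.

(* The form of [#|S| >= #|set nat|] for which Koenig's argument is direct. *)
Definition covers (S : set (set nat)) : Prop :=
  exists h : set nat -> set nat, forall x, exists2 s, S s & h s = x.

(* The power set of [nat] is the set of its own sequences,
   and the [n]-th coordinates of the [n]-th members of the finite sets do not
   exhaust it. *)
Lemma finite_sets_miss (S : set (set nat)) (f : set nat -> set (set nat)) :
  ~ covers S -> (forall s, S s -> finite_set (f s)) ->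
  exists j, forall s, S s -> ~ f s j.
Proof.
move=> nS finf; apply: contrapT => /forallNP all.
have enum s : exists e : nat -> set nat, S s -> f s `<=` range e.
  have [Ss|] := pselect (S s); last by exists (fun=> set0).
  have /finite_seqP[t tE] := finf _ Ss.
  exists (nth set0 t) => _ x; rewrite tE /= => xt; exists (index x t) => //.
  by rewrite nth_index.
have [e eP] := choice enum.
(* Otherwise the diagonal map [s |-> decode (e s n) n] would show that [S] covers. *)
have new n : exists x, forall s, S s -> decode (e s n) n <> x.
  apply: contrapT => /forallNP H; apply: nS; exists (fun s => decode (e s n) n) => x.
  by have /existsNP[s /not_implyP[Ss /contrapT ex]] := H x; exists s.
have [x xP] := choice new.
have [j jx] := decode_surj x; apply: (all j) => s Ss /(eP s Ss)[n _ ej].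
by apply: (xP n s Ss); rewrite ej jx.
Qed.

(** A substitute for indexing by the cardinal of the continuum: if some segment covers, take the
    least such one. The segments below its members are small, so it consists of admissible indices
    and already maps onto the power set. *)
Lemma small_segments (lt : set nat -> set nat -> Prop) :
  well_founded lt -> (forall x y z, lt x y -> lt y z -> lt x z) ->
  (forall x y, [\/ lt x y, x = y | lt y x]) ->
  covers [set t | ~ covers (lt^~ t)].
Proof.
move=> wf tr tot; have [all|] := pselect (forall t, ~ covers (lt^~ t)).
  by exists id => x; exists x => //=.
move=> /existsNP[t /contrapT]; elim/(well_founded_ind wf) : t => t IH tcov.
have [[s st scov]|H] := pselect (exists2 s, lt s t & covers (lt^~ s)).
  exact: IH s st scov.
have [h hP] := tcov; exists h => x; have [s st sx] := hP x; exists s => //= scov.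
by apply: H; exists s.
Qed.

(** [d.1] collects the columns used up at one stage and [d.2] the sets added there; [K] and [G] are
    what the earlier stages have accumulated. *)
Definition task (d : set (set nat) * set (set nat)) (C : nat -> set nat)
    (K G : set (set nat)) : Prop :=
  [/\ finite_set d.1, independent (G `|` d.2) (K `|` d.1) &
    vanishing C -> handled C d.2].

Lemma independent_limit (lt : set nat -> set nat -> Prop)
    (F : set nat -> set (set nat) * set (set nat)) (E : set (set nat)) :
  (forall x y z, lt x y -> lt y z -> lt x z) ->
  (forall x y, [\/ lt x y, x = y | lt y x]) ->
  (forall s t, E t -> lt s t -> E s) ->
  (forall t, E t -> independent (\bigcup_(s in lt^~ t) (F s).2 `|` (F t).2)
                                (\bigcup_(s in lt^~ t) (F s).1 `|` (F t).1)) ->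
  independent (\bigcup_(t in E) (F t).2) (\bigcup_(t in E) (F t).1).
Proof.
move=> tr tot down EF g gG c uc cK.
have [g0|[t Et gt]] : (forall X, X \notin g) \/ exists2 t, E t & forall X, X \in g ->
    (\bigcup_(s in lt^~ t) (F s).2 `|` (F t).2) X.
- elim: g gG => [|Y g IH] gG; first by left.
  right; have [t Et YF] := gG Y (mem_head _ _).
  have [|g0|[s Es gs]] := IH.
  + by move=> X Xg; apply: gG; rewrite in_cons Xg orbT.
  + exists t => // X; rewrite in_cons (negbTE (g0 X)) orbF => /eqP ->; by right.
  have mono u v : lt u v -> (\bigcup_(s in lt^~ u) (F s).2 `|` (F u).2) `<=`
      (\bigcup_(s in lt^~ v) (F s).2 `|` (F v).2).
    move=> uv X [[w wu FX]|FX]; left; last by exists u.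
    by exists w => //; exact: tr uv.
  have [ts|ts|st] := tot t s.
  + exists s => // X; rewrite in_cons => /orP[/eqP ->|/gs//].
    by apply: (mono t) => //; right.
  + rewrite ts in YF Et *; exists s => // X; rewrite in_cons => /orP[/eqP ->|/gs//].
    by right.
  + exists t => // X; rewrite in_cons => /orP[/eqP ->|/gs]; first by right.
    exact: mono.
- apply: independent0 => // [X Xg|j _ []]; by have := g0 X; rewrite Xg.
- apply: (EF t Et) => // j jc; have jK := cK j jc.
  by move=> [[s st Fj]|Fj]; apply: jK; [exists s => //; exact: down st|exists t].
Qed.

Lemma handled_all : exists G : set (set nat),
  (forall g, (forall X, X \in g -> G X) -> infinite_set (meet g)) /\
  forall C, vanishing C -> handled C G.
Proof.
have [lt [wf tr tot]] := well_founded_total_order (set nat).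
have [g gP] := small_segments wf tr tot.
pose data := (set (set nat) * set (set nat))%type.
pose step t (prev : set nat -> data) : data :=
  xget (set0, set0) [set d | task d (decode (g t))
    (\bigcup_s (prev s).1) (\bigcup_s (prev s).2)].
(* Stages not below [t] are read as [(set0, set0)], which adds nothing to the unions in [step]. *)
pose rec := Fix wf (fun=> data) (fun t F =>
  step t (fun s => if pselect (lt s t) is left h then F s h else (set0, set0))).
have recE t : rec t = step t (fun s => if pselect (lt s t) then rec s else (set0, set0)).
  rewrite /rec Fix_eq; first by congr step; apply/funext => s; case: pselect.
  move=> x f f' ff'; congr step; apply/funext => s; case: pselect => //.
have unionE u (pr : data -> set (set nat)) : pr (set0, set0) = set0 ->
    \bigcup_s pr (if pselect (lt s u) then rec s else (set0, set0)) =
    \bigcup_(s in lt^~ u) pr (rec s).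
  move=> pr0; apply/seteqP; split=> X [s su] sX; last by exists s => //; case: pselect.
  by move: sX; case: (pselect (lt s u)) => /= [lsu ?|_]; [exists s|rewrite pr0].
have taskP t : ~ covers (lt^~ t) -> task (rec t) (decode (g t))
    (\bigcup_(s in lt^~ t) (rec s).1) (\bigcup_(s in lt^~ t) (rec s).2).
  elim/(well_founded_ind wf) : t => t IH nt.
  have nlt s : lt s t -> ~ covers (lt^~ s).
    move=> st [h hP]; apply: nt; exists h => x; have [u us ux] := hP x.
    by exists u => //; exact: tr st.
  have {}IH s (st : lt s t) := IH s st (nlt s st).
  rewrite [in task (rec t)]recE /step (unionE t fst) // (unionE t snd) //.
  set P := (X in xget _ X); suff [d dP] : exists d, P d by exact: (xgetPex _ (ex_intro _ d dP)).
  (* Each earlier stage has used finitely many columns and the segment is small, so a fresh column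
     is left. *)
  have [|j jP] := finite_sets_miss (f := fun s => (rec s).1) nt.
    by move=> s /IH[].
  have ind : independent (\bigcup_(s in lt^~ t) (rec s).2) (\bigcup_(s in lt^~ t) (rec s).1).
    apply: (independent_limit tr tot) => [s u ut su|s st]; first exact: tr ut.
    by have [] := IH s st.
  have [vC|nvC] := pselect (vanishing (decode (g t))).
    have [|tau [F [? ? ?]]] := independent_step vC ind (j := j); last by exists (tau, F).
    by move=> [s st]; exact: jP.
  by exists (set0, set0); split => //=; rewrite !setU0.
exists (\bigcup_(t in [set t | ~ covers (lt^~ t)]) (rec t).2); split=> [X XG|C vC].
  have ind : independent (\bigcup_(t in [set t | ~ covers (lt^~ t)]) (rec t).2)
      (\bigcup_(t in [set t | ~ covers (lt^~ t)]) (rec t).1).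
    apply: (independent_limit tr tot) => [s t nt st [h hP]|t /taskP[]//].
    apply: nt; exists h => x; have [u us ux] := hP x.
    by exists u => //; exact: tr st.
  by apply: sub_infinite_set (ind X XG [::] _ _) => // k [].
have [X XC] := decode_surj C; have [t nt tX] := gP X.
have [_ _] := taskP t nt; rewrite tX XC => /(_ vC) [[n Fn]|[D [FD DP]]].
  by left; exists n, t.
by right; exists D; split=> // i; exists t.
Qed.

(** * Existence of OK points and their position relative to ccc sets *)

Lemma stone_setU A B : stone_set (A `|` B) = stone_set A `|` stone_set B.
Proof.
by rewrite -[A `|` B]setCK setCU stone_setC stone_setI !stone_setC setCI !setCK.
Qed.

Lemma stone_setS A B : A `<=` B -> stone_set A `<=` stone_set B.
Proof. by move=> AB [F FU]; exact: filterS. Qed.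

Lemma stone_setTE u : stone_set setT u.
Proof. by rewrite stone_setT. Qed.

Lemma stone_meet g u : stone_set (meet g) u <-> forall X, X \in g -> stone_set X u.
Proof.
split=> [gu X Xg|]; first by apply: stone_setS gu => k; exact.
elim: g => [_|Y g IH gu]; first by apply: stone_setS (stone_setTE u) => k _ X.
apply: (@stone_setS (Y `&` meet g)) => [k [Yk gk] X|].
  by rewrite in_cons => /orP[/eqP ->//|/gk].
rewrite stone_setI; split; first by apply: gu; exact: mem_head.
by apply: IH => X Xg; apply: gu; rewrite in_cons Xg orbT.
Qed.

Lemma omega_star_finite u F : omega_star u -> finite_set F -> ~ stone_set F u.
Proof.
move=> ou /finite_seqP[s ->]; elim: s => [|x s IH].
  by rewrite (_ : [set` [::]] = set0) ?stone_set0 //; apply/seteqP; split.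
have -> : [set` x :: s] = [set x] `|` [set` s].
  apply/seteqP; split=> y /=; rewrite in_cons; first by move=> /orP[/eqP|]; [left|right].
  by move=> [->|->]; rewrite ?eqxx ?orbT.
by rewrite stone_setU stone_set1 => -[ux|//]; apply: ou; exists x.
Qed.

Lemma omega_star_mod_finite u A B : omega_star u -> finite_set (A `\` B) ->
  stone_set A u -> stone_set B u.
Proof.
move=> ou fin Au; have := omega_star_finite ou fin.
by rewrite setDE stone_setI stone_setC => /not_andP[//|/contrapT].
Qed.

(* Kunen's OK points, with [U] ranging over all sequences of sets in [p] and
   the refinement indexed by the uncountable type [set nat]. *)
Definition ok_point (p : beta_omega) : Prop :=
  forall U : nat -> set nat, (forall n, stone_set (U n) p) ->
  exists D : set nat -> set nat, (forall i, stone_set (D i) p) /\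
    forall s, uniq s -> s != [::] -> finite_set (meet (map D s) `\` U (size s)).

Lemma ok_point_exists : exists2 p, omega_star p & ok_point p.
Proof.
have [G [Ginf GH]] := handled_all.
(* The filter generated by [G] and the cofinite sets; it is proper because finite meets from [G] are
   infinite. *)
pose F : set_system nat :=
  [set B | exists2 g, (forall X, X \in g -> G X) & finite_set (meet g `\` B)].
have FF : ProperFilter F.
  split; first by move=> [g gG]; rewrite setD0; exact: Ginf.
  split.
  - by exists [::] => //; rewrite setDT.
  - move=> B C [g gG gB] [h hG hC]; exists (g ++ h).
      by move=> X; rewrite mem_cat => /orP[/gG|/hG].
    have : finite_set ((meet g `\` B) `|` (meet h `\` C)) by rewrite finite_setU.
    apply: sub_finite_set => k [ghk /not_andP[nB|nC]]; [left|right]; split=> // X Xg;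
    by apply: ghk; rewrite mem_cat Xg ?orbT.
  - move=> B C BC [g gG gB]; exists g => //.
    by apply: sub_finite_set gB; exact: setDS.
have [H [HU FH]] := ultraFilterLemma FF.
pose p : beta_omega := exist _ H HU.
have pcof B : finite_set (~` B) -> stone_set B p.
  by move=> fB; apply: FH; exists [::] => //; apply: sub_finite_set fB => k [].
have pG X : G X -> stone_set X p.
  move=> GX; apply: FH; exists [:: X] => [Y|]; first by rewrite inE => /eqP ->.
  rewrite (_ : _ `\` _ = set0) //; apply/seteqP; split=> // k [mk]; apply.
  by apply: mk; rewrite inE.
have op : omega_star p.
  move=> [n _ np]; have : stone_set (~` [set n]) p.
    by apply: pcof; rewrite setCK.
  by rewrite -np => /stone_set_principal; apply.
exists p => // U pU.
(* Intersecting [U 0], ..., [U n] makes the sequence decrease, and dropping the numbers below [n]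
   makes it vanish. All [C n] are in [p], which excludes the first case of [handled]. *)
pose C n := [set k | n <= k]%N `&` meet (mkseq U n.+1).
have pC n : stone_set (C n) p.
  rewrite stone_setI; split.
    apply: pcof; apply: sub_finite_set (finite_II n) => k /=.
    by move/negP; rewrite -ltnNge.
  by apply/stone_meet => X /mapP[m _ ->].
have vC : vanishing C.
  split=> [n k [/= nk mk]|k]; last by exists k.+1 => -[/=]; rewrite ltnn.
  split=> [|X /mapP[m mn ->]] /=; first exact: ltnW.
  apply: mk; apply/map_f; move: mn; rewrite !mem_iota /= !add0n => /leq_trans; exact.
have [[n GC]|[D [GD DP]]] := GH C vC.
  by have := pG _ GC; rewrite stone_setC => /(_ (pC n)).
exists D; split=> [i|s us s0]; first exact: pG.
apply: sub_finite_set (DP s us s0); apply: setDS => k [_]; apply.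
by apply/map_f; rewrite mem_iota /= add0n.
Qed.

(* The countable chain condition of the subspace [M] for basic open sets. *)
Definition ccc_on (M : set beta_omega) : Prop :=
  forall (I : choiceType) (D : set I) (O : I -> set nat),
    (forall i, D i -> (M `&` stone_set (O i)) !=set0) ->
    (forall i j, D i -> D j -> i <> j ->
       forall x, M x -> stone_set (O i) x -> ~ stone_set (O j) x) ->
    countable D.

(** Induction on the order [n] of the family. Intersections of [n+1] members that meet [M] are
    pairwise disjoint on [M], since a common point would lie in more than [n+1] members; hence there
    are countably many. The members that occur in none of them form a family of order [n]. *)
Lemma ccc_on_point_bounded M n (E : set (set nat)) (O : set nat -> set nat) :
  ccc_on M ->
  (forall i, E i -> (M `&` stone_set (O i)) !=set0) ->
  (forall x s, M x -> uniq s ->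
     (forall i, i \in s -> E i /\ stone_set (O i) x) -> (size s <= n)%N) ->
  countable E.
Proof.
move=> cM; elim: n E => [|n IH] E EM bd.
  rewrite (_ : E = set0) //; apply/seteqP; split=> // i Ei.
  have [x [Mx xi]] := EM i Ei; have := bd x [:: i] Mx isT.
  by rewrite ltnn => H; apply/notF/H => j; rewrite inE => /eqP ->.
pose D := [set s : {fset set nat} | [/\ #|` s| = n.+1,
  forall i, i \in s -> E i & exists2 x, M x & forall i, i \in s -> stone_set (O i) x]].
have cD : countable D.
  apply: (cM _ D (fun s => meet (map O (enum_fset s)))) => [s [_ _ [x Mx xs]]|].
    by exists x; split=> //; apply/stone_meet => _ /mapP[i si ->]; exact: xs.
  move=> s t [sn sE _] [tn tE _] st x Mx /stone_meet xs /stone_meet xt; apply: st.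
  have : (#|` (s `|` t)%fset| <= n.+1)%N.
    apply: (bd x) => // [|i]; first exact: fset_uniq.
    rewrite in_fsetU => /orP[si|ti].
      by split; [exact: sE|apply/xs/map_f].
    by split; [exact: tE|apply/xt/map_f].
  move=> le; have e1 : (s = s `|` t)%fset.
    by apply/eqP; rewrite eqEfcard fsubsetUl /= sn.
  have e2 : (t = s `|` t)%fset.
    by apply/eqP; rewrite eqEfcard fsubsetUr /= tn.
  by rewrite e1 -e2.
pose E0 := \bigcup_(s in D) [set` s].
have cE0 : countable E0.
  by apply: bigcup_countable => // s _; exact: countable_fset.
suff cE : countable (E `\` E0).
  have cU : countable (\bigcup_(b in [set: bool]) if b then E0 else E `\` E0).
    by apply: bigcup_countable => // -[].
  apply: sub_countable cU; apply: subset_card_le => i Ei.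
  by have [iE0|iE0] := pselect (E0 i); [exists true|exists false].
apply: IH => [i [/EM //]|x s Mx us sP].
have := bd x s Mx us; rewrite leq_eqVlt ltnS => H.
have /orP[/eqP sn|//] : (size s == n.+1) || (size s <= n)%N.
  by apply: H => i /sP[[]].
case: s us sP sn {H} => // i s us sP sn.
have [[_ nE0] _] := sP i (mem_head _ _); exfalso; apply: nE0.
exists [fset j in i :: s]%fset; last by rewrite /= !inE eqxx.
split.
- by rewrite card_fseq undup_id.
- by move=> j; rewrite !inE => /sP[[]].
- by exists x => // j; rewrite !inE => /sP[].
Qed.

Lemma set_nat_uncountable : ~ countable [set: set nat].
Proof.
move=> /countable_injP[f finj].
pose X := [set k | exists2 B, f B = k & ~ B k].
have nX : ~ X (f X).
  move=> XX; have [B fB nB] := XX; apply: nB.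
  by rewrite (_ : B = X) //; apply: finj => //; exact: in_setT.
by apply: (nX); exists X.
Qed.

Lemma ok_point_ccc p M : ok_point p -> M `<=` omega_star -> ~ M p -> ccc_on M ->
  exists2 A, stone_set A p & M `<=` ~` stone_set A.
Proof.
move=> okp Mo Mp cM; apply: contrapT => nA.
have meetsM A : stone_set A p -> (M `&` stone_set A) !=set0.
  move=> pA; apply: contrapT => H; apply: nA; exists A => // x Mx xA.
  by apply: H; exists x.
pose P (E : set (set nat)) :=
  (forall B, E B -> ~ stone_set B p /\ (M `&` stone_set B) !=set0) /\
  (forall B C, E B -> E C -> B <> C ->
     forall x, M x -> stone_set B x -> ~ stone_set C x).
have [E [PE maxE]] : exists E, P E /\ forall F, E `<` F -> ~ P F.
  apply: Zorn_bigcup => F FP Ftot; split=> [B [X FX XB]|B C [X FX XB] [Y FY YC]].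
    by have [XP _] := FP X FX; exact: XP.
  have [XY|YX] := Ftot X Y FX FY.
    by apply: (FP Y FY).2 => //; exact: XY.
  by apply: (FP X FX).2 => //; exact: YX.
have [EP dE] := PE.
have /countable_injP[f finj] : countable E.
  by apply: (cM _ E id) => // B /EP[].
(* An enumeration of [E]; the default [set0] is harmless because [stone_set set0] is empty. *)
pose e n := xget set0 [set B | E B /\ f B = n].
have ep n : ~ stone_set (e n) p.
  rewrite /e; case: xgetP => [B _ [/EP[]//]|_].
  by rewrite stone_set0.
have eE B : E B -> e (f B) = B.
  move=> EB; rewrite /e; case: xgetP => [C _ [EC fC]|/(_ B)]; last by case.
  by apply: finj => //; exact/mem_set.
have [|D [pD DP]] := okp (fun n => meet (mkseq (fun m => ~` e m) n.+1)).
  by move=> n; apply/stone_meet => X /mapP[m _ ->]; rewrite stone_setC; exact: ep.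
have ex i : exists n, (M `&` stone_set (D i `&` e n)) !=set0.
  have [x [Mx xD]] := meetsM _ (pD i).
  have [B xB pB] : exists2 B, stone_set B x & ~ stone_set B p.
    apply: contrapT => H; apply: Mp; rewrite -(@beta_omega_eq x p) // => B xB.
    by apply: contrapT => pB; apply: H; exists B.
  (* If [C] met no member of [E] on [M], it could be added to [E], against maximality; cutting with
     [B] keeps [C] out of [p]. *)
  pose C := D i `&` B.
  have xC : stone_set C x by rewrite stone_setI.
  have pC : ~ stone_set C p by rewrite stone_setI => -[].
  apply: contrapT => /forallNP nn.
  have disj B' : E B' -> forall y, M y -> stone_set C y -> ~ stone_set B' y.
    move=> EB' y My yC yB'; apply: (nn (f B')); exists y; split => //.
    rewrite eE // stone_setI; split=> //; move: yC; rewrite stone_setI; by case.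
  apply: (maxE (C |` E)).
    split=> [|sub]; first by move=> Y EY; right.
    have EC : E C by apply: sub; left.
    exact: (disj C EC x).
  split=> [Y [->|/EP//]|Y Z]; first by split=> //; exists x.
  move=> [->|EY] [->|EZ] // YZ y My.
  - exact: disj.
  - by move=> yY yC; exact: (disj Y EY y).
  - exact: dE.
have [n nP] := choice ex.
apply: set_nat_uncountable.
rewrite (_ : setT = \bigcup_k [set i | n i = k]); last first.
  by apply/seteqP; split=> // i _; exists (n i).
apply: bigcup_countable => // k _.
(* If [x] is in more than [k] of the sets, it is in [U (size s)], as finite errors do not matter for
   nonprincipal [x]. Since [k <= size s], this set misses [e k]. *)
apply: (@ccc_on_point_bounded M k _ (fun i => D i `&` e k)) => // [i /= <-//|x s Mx us sP].
rewrite leqNgt; apply/negP => ks.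
have s0 : s != [::] by case: s ks {us sP}.
have xD : stone_set (meet (map D s)) x.
  by apply/stone_meet => _ /mapP[i si ->]; have [_] := sP i si; rewrite stone_setI => -[].
have := omega_star_mod_finite (Mo _ Mx) (DP s us s0) xD.
move/stone_meet/(_ (~` e k)); rewrite stone_setC; apply.
  by apply: (map_f (fun m => ~` e m)); rewrite mem_iota /= add0n ltnS ltnW.
case: s s0 sP {us ks xD} => // i s _ /(_ i (mem_head _ _))[_].
by rewrite stone_setI => -[].
Qed.

Local Open Scope ring_scope.

(** * Radon measures and tightness *)

Definition is_compact_open (X : topologicalType) (C : set X) : Prop :=
  compact C /\ open C.

Definition compact_open_base (X : topologicalType) : Prop :=
  forall (x : X) V, nbhs x V -> exists C, [/\ is_compact_open C, C x & C `<=` V].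

(** * The ring of compact open sets and induction over compact sets *)

Section compact_open_sets.
Context (X : ptopologicalType).
Hypothesis hX : hausdorff_space X.
Implicit Types A B C : set X.

Lemma compact_open0 : @is_compact_open X set0.
Proof. by split; [exact: compact0|exact: open0]. Qed.

Lemma compact_openU A B : is_compact_open A -> is_compact_open B -> is_compact_open (A `|` B).
Proof. by move=> [cA oA] [cB oB]; split; [exact: compactU|exact: openU]. Qed.

Lemma compact_openD A B : is_compact_open A -> is_compact_open B -> is_compact_open (A `\` B).
Proof.
move=> [cA oA] [cB oB]; split; rewrite setDE.
  by apply: compact_closedI => //; exact: open_closedC.
by apply: openI => //; apply: closed_openC; exact: compact_closed.
Qed.

Lemma compact_openI A B : is_compact_open A -> is_compact_open B -> is_compact_open (A `&` B).
Proof. by move=> cA cB; rewrite -setDD; do 2 apply: compact_openD => //. Qed.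

Lemma compact_open_bigsetU (E : nat -> set X) n :
  (forall k, is_compact_open (E k)) -> is_compact_open (\big[setU/set0]_(k < n) E k).
Proof.
move=> cE; elim/big_ind : _ => //; first exact: compact_open0.
exact: compact_openU.
Qed.

(** The union of a finite subcover by open sets satisfying [Q] is the required set. *)
Lemma compact_ind A (Q : set X -> Prop) : compact A -> Q set0 ->
  (forall U V, Q U -> Q V -> Q (U `|` V)) ->
  (forall x, A x -> exists2 U, open_nbhs x U & Q U) ->
  exists2 U, A `<=` U & Q U.
Proof.
move=> cA Q0 QU Qloc.
have ex x : exists U, A x -> open_nbhs x U /\ Q U.
  have [Ax|nAx] := pselect (A x); last by exists set0.
  by have [U xU qU] := Qloc x Ax; exists U.
have [f fP] := choice ex.
have /(_ _ A f)[||D DA AD] : cover_compact A by rewrite -compact_cover.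
- by move=> x /fP[[]].
- by move=> x Ax; exists x => //; have [[]] := fP x Ax.
exists (\bigcup_(i in [set` D]) f i) => //.
rewrite bigcup_fset big_seq; elim/big_ind : _ => // i iD.
by have /set_mem/fP[] := DA i iD.
Qed.
End compact_open_sets.

Section borel_sets.
Context (R : realType) (X : ptopologicalType).

Lemma borel_open (U : set X) : open U -> measurable (U : set (borel X)).
Proof. by move=> oU; apply: sub_gen_smallest. Qed.

Lemma borel_closed (U : set X) : closed U -> measurable (U : set (borel X)).
Proof.
move=> cU; rewrite -[U]setCK; apply: measurableC; apply: borel_open.
exact: closed_openC.
Qed.

Lemma continuous_borel_measurable (f : X -> R) :
  continuous f -> measurable_fun setT (f : borel X -> R).
Proof.
move=> cf; apply: (measurability _ (RGenOInfty.measurableE R)) => _ [_ [r ->] <-].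
rewrite setTI; apply: borel_open; exact: open_comp.
Qed.

Lemma bounded_integrable (mu : probability (borel X) R) (f : borel X -> R) K :
  measurable_fun setT f -> (forall x, `|f x| <= K) -> mu.-integrable setT (EFin \o f).
Proof.
move=> mf bf; apply: measurable_bounded_integrable => //.
  by apply: le_lt_trans (probability_le1 mu measurableT) (ltry _).
by exists K; split=> [|y Ky x _]; [exact: num_real|exact: le_trans (bf x) (ltW Ky)].
Qed.

End borel_sets.

(** * From a content on the compact open sets to a Radon measure *)

Section content_extension.
Context (R : realType) (X : ptopologicalType).
Hypotheses (hX : hausdorff_space X) (bX : compact_open_base X).
Variable m : set X -> R.
Hypothesis m_ge0 : forall C, 0 <= m C.
Hypothesis mU : forall A B, is_compact_open A -> is_compact_open B ->
  A `&` B = set0 -> m (A `|` B) = m A + m B.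
Hypothesis m_le1 : forall C, m C <= 1.

Lemma content0 : m set0 = 0.
Proof.
have := mU (@compact_open0 X) (@compact_open0 X) (setI0 _).
by rewrite setU0 => H; lra.
Qed.

Lemma le_content A B : is_compact_open A -> is_compact_open B -> A `<=` B -> m A <= m B.
Proof.
move=> cA cB AB; have -> : B = A `|` (B `\` A) by rewrite setDUK.
rewrite mU //; [|exact: compact_openD|by rewrite setDIK].
by rewrite lerDl.
Qed.

Lemma content_subadd A B : is_compact_open A -> is_compact_open B -> m (A `|` B) <= m A + m B.
Proof.
move=> cA cB; have -> : A `|` B = A `|` (B `\` A) by rewrite setUDr setDv setD0.
have cD := compact_openD hX cB cA.
rewrite mU //; last by rewrite setDIK.
by rewrite lerD2l; apply: le_content.
Qed.

Lemma content_bigsetU (E : nat -> set X) n : (forall k, is_compact_open (E k)) ->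
  m (\big[setU/set0]_(k < n) E k) <= \sum_(k < n) m (E k).
Proof.
move=> cE; elim: n => [|n IH]; first by rewrite !big_ord0 content0.
rewrite !big_ord_recr /=; apply: (le_trans (content_subadd _ _)) => //.
  exact: compact_open_bigsetU.
by rewrite lerD2r.
Qed.

Local Open Scope ereal_scope.

Definition inner (U : set X) : \bar R :=
  ereal_sup [set (m C)%:E | C in [set C | is_compact_open C /\ C `<=` U]].

Lemma inner_ge C U : is_compact_open C -> C `<=` U -> (m C)%:E <= inner U.
Proof. by move=> cC CU; apply: ereal_sup_ubound; exists C. Qed.

Lemma inner_ge0 U : 0 <= inner U.
Proof.
apply: (@le_trans _ _ (m set0)%:E); first by rewrite lee_fin.
by apply: inner_ge => //; exact: compact_open0.
Qed.

Lemma le_inner U V : U `<=` V -> inner U <= inner V.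
Proof.
move=> UV; apply: ge_ereal_sup => _ [C [cC CU] <-].
by apply: inner_ge => //; exact: subset_trans UV.
Qed.

Lemma inner_compact_open C : is_compact_open C -> inner C = (m C)%:E.
Proof.
move=> cC; apply/eqP; rewrite eq_le (@inner_ge C) // andbT.
by apply: ge_ereal_sup => _ [D [cD DC] <-]; rewrite lee_fin le_content.
Qed.

Lemma inner_le1 U : inner U <= 1.
Proof. by apply: ge_ereal_sup => _ [D [cD DC] <-]; rewrite lee_fin. Qed.

(** A compact open subset of the union is covered by finitely many compact open [E k] with [E k]
    inside [U k], so that finite subadditivity of [m] suffices. *)
Lemma inner_sigma_subadditive (U : nat -> set X) : (forall n, open (U n)) ->
  inner (\bigcup_n U n) <= \sum_(n <oo) inner (U n).
Proof.
move=> oU; apply: ge_ereal_sup => _ [C [cC CU] <-].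
pose Q V := exists n, exists2 E : nat -> set X,
  (forall k, is_compact_open (E k) /\ E k `<=` U k) & V `<=` \big[setU/set0]_(k < n) E k.
have [|V W [n [E EP VE]] [n' [E' EP' WE']]|x Cx|V CV [n [E EP VE]]] :=
    @compact_ind _ C Q cC.1.
- exists 0%N, (fun=> set0) => // k; split=> //; exact: compact_open0.
- exists (maxn n n'), (fun k => E k `|` E' k).
    move=> k; have [cE EU] := EP k; have [cE' EU'] := EP' k; split.
      exact: compact_openU.
    by rewrite subUset.
  rewrite -(bigcup_mkord _ (fun k => E k `|` E' k)) subUset; split.
    move=> x /VE; rewrite -bigcup_mkord => -[k kn Ex]; exists k => /=; last by left.
    by rewrite (leq_trans kn) ?leq_maxl.
  move=> x /WE'; rewrite -bigcup_mkord => -[k kn Ex]; exists k => /=; last by right.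
  by rewrite (leq_trans kn) ?leq_maxr.
- have [k _ Ukx] := CU x Cx.
  have [D [cD Dx DU]] := bX (open_nbhs_nbhs (conj (oU k) Ukx)).
  exists D; first by split=> //; exact: cD.2.
  exists k.+1, (fun i => if i == k then D else set0).
    by move=> i; case: eqP => [->//|_]; split=> //; exact: compact_open0.
  by rewrite big_ord_recr /= eqxx; exact: subsetUr.
have cE k := (EP k).1.
apply: (@le_trans _ _ (\sum_(k < n) m (E k))%:E).
  rewrite lee_fin (le_trans _ (content_bigsetU n cE)) //.
  by apply: le_content => //; [exact: compact_open_bigsetU|exact: subset_trans VE].
rewrite -sumEFin -(big_mkord xpredT (fun k => (m (E k))%:E)).
apply: le_trans (nneseries_lim_ge n _); last by move=> k _ _; exact: inner_ge0.
by apply: lee_sum => k _; apply: inner_ge; have [] := EP k.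
Qed.

Definition outer (A : set X) : \bar R :=
  ereal_inf [set inner U | U in [set U | open U /\ A `<=` U]].

Lemma outer_le A U : open U -> A `<=` U -> outer A <= inner U.
Proof. by move=> oU AU; apply: ereal_inf_lbound; exists U. Qed.

Lemma outer_open U : open U -> outer U = inner U.
Proof.
move=> oU; apply/eqP; rewrite eq_le outer_le //=.
by apply: le_ereal_inf_tmp => _ [V [oV UV] <-]; exact: le_inner.
Qed.

Lemma outer_ge0 A : 0 <= outer A.
Proof. by apply: le_ereal_inf_tmp => _ [V [oV UV] <-]; exact: inner_ge0. Qed.

Lemma outer0 : outer set0 = 0.
Proof.
by rewrite outer_open ?inner_compact_open ?content0 //; [exact: compact_open0|exact: open0].
Qed.

Lemma le_outer : {homo outer : A B / A `<=` B >-> A <= B}.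
Proof.
move=> A B AB; apply: le_ereal_inf_tmp => _ [V [oV BV] <-].
by apply: outer_le => //; exact: subset_trans BV.
Qed.

Lemma outer_fin_num A : outer A \is a fin_num.
Proof.
rewrite ge0_fin_numE ?outer_ge0 //.
apply: le_lt_trans (ltry 1); apply: le_trans (inner_le1 setT).
by apply: outer_le => //; exact: openT.
Qed.

Lemma outer_approx A (e : R) : (0 < e)%R ->
  exists U, [/\ open U, A `<=` U & inner U <= outer A + e%:E].
Proof.
move=> e0; have [_ [U [oU AU] <-] lt] := lb_ereal_inf_adherent e0 (outer_fin_num A).
by exists U; split=> //; exact: ltW.
Qed.

Lemma outer_sigma_subadditive : sigma_subadditive outer.
Proof.
move=> F; apply/lee_addgt0Pr => _/posnumP[e].
apply: le_trans (epsilon_trick _ _ _) => //; last by move=> n; exact: outer_ge0.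
have ex n : exists U, [/\ open U, F n `<=` U &
    inner U <= outer (F n) + (e%:num / (2 ^ n.+1)%:R)%:E] by exact: outer_approx.
have [U UP] := choice ex.
have oU n : open (U n) by have [] := UP n.
apply: (@le_trans _ _ (inner (\bigcup_n U n))).
  apply: outer_le; first exact: bigcup_open.
  by apply: subset_bigcup => n _; have [] := UP n.
apply: le_trans (inner_sigma_subadditive oU) _.
by apply: lee_nneseries => [n _ _|n _]; [exact: inner_ge0|have [] := UP n].
Qed.

HB.instance Definition _ := isOuterMeasure.Build R X outer
  outer0 outer_ge0 le_outer outer_sigma_subadditive.

(** For open [V] containing [A], exhaust [V]&[U] by a compact open [C], and then the open set
    [V]\[C], which contains the part of [V] outside [U], by a compact open [D]. The two are disjoint
    and both inside [V]. *)
Lemma outer_caratheodory U : open U -> outer.-caratheodory U.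
Proof.
move=> oU; apply: le_caratheodory_measurable => A.
apply: le_ereal_inf_tmp => _ [V [oV AV] <-].
apply: (@le_trans _ _ (outer (V `&` U) + outer (V `&` ~` U))).
  by apply: leeD; apply: le_outer; exact: setSI.
rewrite outer_open; last exact: openI.
rewrite -leeBrDr; last exact: outer_fin_num.
apply: ge_ereal_sup => _ [C [cC CVU] <-].
rewrite leeBrDr; last exact: outer_fin_num.
have oVC : open (V `\` C).
  by rewrite setDE; apply: openI => //; apply: closed_openC; exact: compact_closed cC.1.
apply: (@le_trans _ _ ((m C)%:E + inner (V `\` C))).
  rewrite leeD2l //; apply: outer_le => // x [Vx nUx]; split=> // /CVU[_]; exact: nUx.
rewrite addeC -leeBrDr //.
apply: ge_ereal_sup => _ [D [cD DVC] <-].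
rewrite leeBrDr // -EFinD addrC -mU //; last first.
  by apply/seteqP; split=> // x [Cx /DVC[]].
apply: inner_ge; first exact: compact_openU.
by rewrite subUset; split=> x; [move=> /CVU[]|move=> /DVC[]].
Qed.

Lemma outer_borel (A : set (borel X)) : measurable A -> outer.-caratheodory A.
Proof.
pose M : set (set X) := outer.-caratheodory.
have sM : sigma_algebra setT M.
  split=> [|B MB|F MF].
  - exact: caratheodory_measurable_set0.
  - by rewrite setTD; exact: caratheodory_measurable_setC.
  - exact: caratheodory_measurable_bigcup.
by move=> mA; apply: mA; split=> // U; exact: outer_caratheodory.
Qed.

(* The value 0 outside of the Borel sets is the one [radon_probability] asks for. *)
Definition extension (A : set (borel X)) : \bar R :=
  if `[<measurable A>] then outer A else 0.

Lemma extensionE A : measurable A -> extension A = outer A.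
Proof. by move=> mA; rewrite /extension asboolT. Qed.

Lemma extension0 : extension set0 = 0.
Proof. by rewrite extensionE ?outer0. Qed.

Lemma extension_ge0 A : 0 <= extension A.
Proof. by rewrite /extension; case: asboolP => // _; exact: outer_ge0. Qed.

Lemma extension_sigma_additive : semi_sigma_additive extension.
Proof.
move=> F mF tF mUF; rewrite extensionE //.
rewrite (_ : (fun n => _) = (fun n => \sum_(0 <= i < n) outer (F i))).
  by apply: (@caratheodory_measure_sigma_additive R X outer) => // [n|]; exact: outer_borel.
by apply/funext => n; apply: eq_bigr => i _; rewrite extensionE.
Qed.

HB.instance Definition _ := isMeasure.Build _ _ _ extension
  extension0 extension_ge0 extension_sigma_additive.

Hypothesis m_tight : forall e : R, (0 < e)%R -> exists2 C, is_compact_open C & (1 - e <= m C)%R.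

Lemma extension_setT : extension setT = 1.
Proof.
rewrite extensionE // outer_open; last exact: openT.
apply/eqP; rewrite eq_le inner_le1 /=; apply/lee_addgt0Pr => e e0.
have [C cC mC] := m_tight e0; rewrite -leeBlDr //.
by apply: le_trans (inner_ge cC (@subsetT _ _)); rewrite -EFinB lee_fin.
Qed.

HB.instance Definition _ := Measure_isProbability.Build _ _ _ extension extension_setT.

Let P : probability (borel X) R := extension.

Lemma extension_compact_open C : is_compact_open C -> extension C = (m C)%:E.
Proof.
move=> cC; have [_ oC] := cC.
by rewrite extensionE ?outer_open ?inner_compact_open //; exact: borel_open.
Qed.

Lemma extension_radon : radon P.
Proof.
move=> B mB e e0; have e3 : (0 < e / 3)%R by rewrite divr_gt0.
have [U [oU BU innerU]] := outer_approx (~` B) e3.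
have [C cC mC] := m_tight e3.
have mU' : measurable (U : set (borel X)) by exact: borel_open.
have mC' : measurable (C : set (borel X)) by apply: borel_open; exact: cC.2.
have PC : P (~` C) <= (e / 3)%:E.
  rewrite probability_setC //; suff : 1 - extension C <= (e / 3)%:E by [].
  by rewrite extension_compact_open // -EFinB lee_fin; lra.
have PUB : P (U `&` B) <= (e / 3)%:E.
  have mnB := measurableC mB.
  have -> : U `&` B = U `\` ~` B by rewrite setDE setCK.
  rewrite measureD //; last by rewrite (le_lt_trans (probability_le1 P mU')) ?ltry.
  rewrite (setIidr BU) leeBlDr ?fin_num_measure //.
  suff : extension U <= (e / 3)%:E + extension (~` B) by [].
  by rewrite !extensionE // outer_open // addeC.
(* What [B] loses is either outside [C] or in [U]&[B], each of mass at most [e / 3]. *)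
exists (C `&` ~` U); split.
- by apply: compact_closedI; [exact: cC.1|exact: open_closedC].
- by move=> x [_ nUx]; apply: contrapT => nBx; exact/nUx/BU.
apply: (@le_lt_trans _ _ (P (~` C) + P (U `&` B))).
  have mCU : measurable (~` C `|` (U `&` B) : set (borel X)).
    by apply: measurableU; [exact: measurableC|exact: measurableI].
  have mBK : measurable (B `\` (C `&` ~` U) : set (borel X)).
    exact: measurableD mB (measurableI _ _ mC' (measurableC mU')).
  apply: (@le_trans _ _ (P (~` C `|` (U `&` B)))).
    apply: le_measure; [exact/mem_set|exact/mem_set|].
    move=> x [Bx /not_andP[nC|/contrapT Ux]]; [by left|by right].
  by apply: measureU2; [exact: measurableC|exact: measurableI].
apply: (@le_lt_trans _ _ ((e / 3)%:E + (e / 3)%:E)); first exact: leeD.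
by rewrite -EFinD lte_fin; lra.
Qed.

Lemma content_extension : exists mu : radon_probability R X,
  forall C, is_compact_open C -> measure_of mu C = (m C)%:E.
Proof.
have PP : [set mu : probability (borel X) R |
    radon mu /\ forall A, ~ measurable A -> mu A = 0%E] P.
  by split=> [|A nA]; [exact: extension_radon|rewrite /P /= /extension asboolF].
by exists (SigSub (mem_set PP)) => C cC; exact: extension_compact_open.
Qed.

End content_extension.

(** * The weak topology and real-valued masses *)

Section prob_space.
Context (R : realType) (X : ptopologicalType).
Implicit Types (mu nu : radon_probability R X) (f : bounded_continuous R X).

Lemma integral_against_continuous f :
  continuous (integral_against f : prob_space R X -> R).
Proof.
move=> mu; have := @cvg_id _ (nbhs (mu : prob_space R X)).
move=> /cvg_sup/(_ f) cf; apply: cvg_trans (@initial_continuous _ _ _ mu).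
exact: cvg_app cf.
Qed.

Lemma prob_space_cvg (F : set_system (prob_space R X)) (mu : prob_space R X) :
  Filter F -> (forall f, integral_against f nu @[nu --> F] --> integral_against f mu) ->
  F --> mu.
Proof.
move=> FF cF; apply/cvg_sup => f A.
have /= -> := @nbhsE (initial_topology (integral_against f)) mu.
move=> [_ [[B oB <-] Bmu] sub].
apply: filterS sub _; apply: (cF f); exact: open_nbhs_nbhs.
Qed.

Definition mass (A : set X) mu : R := fine (measure_of mu A).

Lemma massE A mu : measurable (A : set (borel X)) -> measure_of mu A = (mass A mu)%:E.
Proof. by move=> mA; rewrite /mass fineK // fin_num_measure. Qed.

Lemma mass_ge0 A mu : 0 <= mass A mu.
Proof. by apply: fine_ge0; exact: measure_ge0. Qed.

Lemma mass_le1 A mu : measurable (A : set (borel X)) -> mass A mu <= 1.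
Proof.
move=> mA; rewrite -lee_fin -massE //; exact: (@probability_le1 _ _ _ (measure_of mu)).
Qed.

Lemma massU A B mu : measurable (A : set (borel X)) -> measurable (B : set (borel X)) ->
  A `&` B = set0 -> mass (A `|` B) mu = mass A mu + mass B mu.
Proof.
move=> mA mB AB; apply: EFin_inj; rewrite EFinD -!massE //; last exact: measurableU.
exact: (@measureU _ _ _ (measure_of mu)).
Qed.

Lemma mass_setC A mu : measurable (A : set (borel X)) -> mass (~` A) mu = 1 - mass A mu.
Proof.
move=> mA; apply: EFin_inj; rewrite EFinB -!massE //; last exact: measurableC.
exact: (@probability_setC _ _ _ (measure_of mu)).
Qed.

Lemma Rintegral_indic mu A : measurable (A : set (borel X)) ->
  Rintegral (measure_of mu) setT (\1_A : X -> R) = mass A mu.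
Proof.
move=> mA; rewrite /Rintegral /mass; congr fine.
have := integral_indic (measure_of mu) measurableT mA.
by rewrite setIT.
Qed.

End prob_space.

(** * Compactness of the closures of tight sets *)

Section tightness.
Context (R : realType) (X : ptopologicalType).
Hypotheses (hX : hausdorff_space X) (bX : compact_open_base X).
Implicit Types (mu nu : radon_probability R X).

Lemma indic_continuous (C : set X) : is_compact_open C -> continuous (\1_C : X -> R).
Proof.
move=> [cC oC] x; have [Cx|nCx] := pselect (C x).
  apply: cvg_near_cst; apply: filterS (open_nbhs_nbhs (conj oC Cx)) => y Cy.
  by rewrite !indicE !mem_set.
have oC' : open (~` C) by apply: closed_openC; exact: compact_closed.
apply: cvg_near_cst; apply: filterS (open_nbhs_nbhs (conj oC' nCx)) => y nCy.
by rewrite !indicE !memNset.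
Qed.

Lemma indic_bounded (C : set X) : bounded_fun (\1_C : X -> R).
Proof.
exists 1; split=> [|y y1 x _]; first exact: num_real.
by rewrite /= indicE; case: (x \in C); rewrite ?normr1 ?normr0; lra.
Qed.

Lemma mass_continuous (C : set X) : is_compact_open C ->
  continuous (mass C : prob_space R X -> R).
Proof.
move=> cC; pose f : bounded_continuous R X :=
  exist _ (\1_C : X -> R) (conj (indic_continuous cC) (indic_bounded C)).
suff -> : mass C = integral_against f by exact: integral_against_continuous.
apply/funext => mu; rewrite /integral_against /= Rintegral_indic //.
by apply: borel_open; have [] := cC.
Qed.

(** The difference is dominated by [e] on [C] and by [K + K] elsewhere, that is, by the function [h]
    below. *)
Lemma Rintegral_close (P : probability (borel X) R) (f g : X -> R) (C : set X) K e d :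
  measurable_fun setT (f : borel X -> R) -> measurable_fun setT (g : borel X -> R) ->
  (forall x, `|f x| <= K) -> (forall x, `|g x| <= K) -> 0 <= e ->
  measurable (C : set (borel X)) -> (P (~` C) <= d%:E)%E ->
  (forall x, C x -> `|f x - g x| <= e) ->
  `|Rintegral P setT f - Rintegral P setT g| <= e + (K + K) * d.
Proof.
move=> mf mg bf bg e0 mC Pd fg.
have intf := bounded_integrable P mf bf.
have intg := bounded_integrable P mg bg.
have mfg : measurable_fun setT (fun x : borel X => f x - g x) by exact: measurable_funB.
have bfg x : `|f x - g x| <= K + K.
  by apply: le_trans (ler_normB _ _) _; exact: lerD.
have K0 : 0 <= K by apply: le_trans (bf point).
rewrite -RintegralB //.
apply: le_trans (le_normr_Rintegral measurableT _) _.
  exact: bounded_integrable bfg.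
have mnC := measurableC mC.
pose h (x : borel X) : R := e + (K + K) * \1_(~` C) x.
have mh : measurable_fun setT h.
  apply: measurable_funD => //; apply: measurable_funM => //.
have bh x : `|h x| <= e + (K + K).
  rewrite /h ger0_norm; last by rewrite addr_ge0 ?mulr_ge0 ?addr_ge0.
  by rewrite lerD2l indicE; case: (_ \in _); rewrite ?mulr1 ?mulr0 ?addr_ge0.
apply: (@le_trans _ _ (Rintegral P setT h)).
  apply: le_Rintegral => //.
  - apply: (@bounded_integrable _ _ P _ (K + K)) => [|x]; last by rewrite normr_id.
    exact: measurableT_comp.
  - exact: bounded_integrable bh.
  - move=> x _; rewrite /h indicE; have [Cx|nCx] := pselect (C x).
      by rewrite memNset ?mulr0 ?addr0; [exact: fg|apply].
    by rewrite mem_set // mulr1 (le_trans (bfg x)) // lerDr.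
have bi x : `|\1_(~` C) x : R| <= 1.
  by rewrite indicE; case: (_ \in _); rewrite ?normr1 ?normr0.
have inti : P.-integrable setT (EFin \o (\1_(~` C) : borel X -> R)).
  by apply: bounded_integrable bi; exact: measurable_indic.
have intK : P.-integrable setT (EFin \o (fun x : borel X => (K + K) * \1_(~` C) x)).
  apply: (@bounded_integrable _ _ P _ (K + K)) => [|x]; first exact: measurable_funM.
  by rewrite normrM (ger0_norm (addr_ge0 K0 K0)) ler_piMr // addr_ge0.
rewrite RintegralD //; last first.
  by apply: (@bounded_integrable _ _ P _ (e)) => // x; rewrite ger0_norm.
rewrite RintegralZl // Rintegral_cst //; apply: lerD.
  rewrite [X in _ * X](_ : _ = 1) ?mulr1 //; exact: (congr1 fine (probability_setT P)).
rewrite ler_wpM2l ?addr_ge0 // -lee_fin; apply: le_trans Pd.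
rewrite /Rintegral; have := integral_indic P measurableT mnC; rewrite setIT => ->.
by rewrite fineK // fin_num_measure.
Qed.

(** Compact open sets are asked for because their masses depend continuously on the measure, so that
    the bounds survive closures and limits. *)
Definition tight (M : set (prob_space R X)) : Prop :=
  forall e : R, 0 < e -> exists2 C, is_compact_open C &
    forall mu, M mu -> 1 - e <= mass C mu.

Lemma tight_closure M : tight M -> tight (closure M).
Proof.
move=> tM e e0; have [C cC MC] := tM e e0; exists C => // mu clmu.
have cl : closed [set nu : prob_space R X | 1 - e <= mass C nu].
  apply: (@closed_comp _ _ (mass C : prob_space R X -> R) [set r | 1 - e <= r]).
    by move=> nu _; exact: mass_continuous.
  exact: closed_ge.
by move: (closure_subset MC clmu); rewrite -(closure_id _).1.
Qed.

Inductive step_function : (X -> R) -> Prop :=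
| step_function0 : step_function (fun=> 0)
| step_functionD g c D : step_function g -> is_compact_open D ->
    step_function (fun x => g x + c * \1_D x).

Lemma step_function_add g h : step_function g -> step_function h ->
  step_function (fun x => g x + h x).
Proof.
move=> sg; elim=> {h} [|h c D sh IH cD].
  by rewrite (_ : (fun _ => _) = g) //; apply/funext => x; rewrite addr0.
rewrite (_ : (fun _ => _) = (fun x => (g x + h x) + c * \1_D x)).
  exact: step_functionD.
by apply/funext => x; rewrite addrA.
Qed.

Lemma step_function_restrict g D : step_function g -> is_compact_open D ->
  step_function (fun x => g x * \1_D x).
Proof.
move=> + cD; elim=> {g} [|g c E sg IH cE].
  rewrite (_ : (fun _ => _) = fun=> 0); first exact: step_function0.
  by apply/funext => x; rewrite mul0r.
rewrite (_ : (fun _ => _) = (fun x => g x * \1_D x + c * \1_(E `&` D) x)).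
  by apply: step_functionD => //; exact: compact_openI.
by apply/funext => x; rewrite indicI mulrDl mulrA.
Qed.

(** Constant functions work locally. Two approximations are glued by restricting the second to
    [W']\[W]; the first vanishes there, so the values do not interfere. *)
Lemma step_function_approx (f : X -> R) C e : continuous f -> compact C -> 0 < e ->
  exists W g, [/\ C `<=` W, step_function g,
    forall x, W x -> `|f x - g x| <= e & forall x, ~ W x -> g x = 0].
Proof.
move=> cf cC e0.
pose Q V := exists W g, [/\ V `<=` W, is_compact_open W, step_function g,
    forall x, W x -> `|f x - g x| <= e & forall x, ~ W x -> g x = 0].
have [|U V [W [g [UW cW sg Wg nWg]]] [W' [g' [VW' cW' sg' Wg' nWg']]]|x Cx|] :=
    @compact_ind _ C Q cC.
- exists set0, (fun=> 0); split=> //; [exact: compact_open0|exact: step_function0].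
- exists (W `|` W'), (fun x => g x + g' x * \1_(W' `\` W) x); split.
  + exact: setUSS.
  + exact: compact_openU.
  + apply: step_function_add => //; apply: step_function_restrict => //.
    exact: compact_openD.
  + move=> x WWx; have [Wx|nWx] := pselect (W x).
      by rewrite indicE memNset ?mulr0 ?addr0; [exact: Wg|case].
    case: WWx => // W'x; rewrite nWg // add0r indicE mem_set // mulr1; exact: Wg'.
  + move=> x /not_orP[nWx nW'x]; rewrite nWg // add0r indicE memNset ?mulr0 //.
    by case.
- have : nbhs x [set y | `|f y - f x| < e].
    have := cf x [set r | `|r - f x| < e]; apply.
    apply/nbhs_ballP; exists e => // r; rewrite /ball /= distrC; exact.
  move=> /bX[D [cD Dx Df]]; exists D; first by split=> //; have [] := cD.
  exists D, (fun y => 0 + f x * \1_D y); split=> //.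
  + by apply: step_functionD => //; exact: step_function0.
  + by move=> y Dy; rewrite indicE mem_set // mulr1 add0r ltW //; exact: Df.
  + by move=> y nDy; rewrite indicE memNset // mulr0 addr0.
move=> V CV [W [g [VW cW sg Wg nWg]]]; exists W, g; split=> //.
exact: subset_trans VW.
Qed.

Lemma step_function_measurable g : step_function g ->
  measurable_fun setT (g : borel X -> R).
Proof.
elim=> {g} [|g c D sg mg [_ oD]]; first exact: measurable_cst.
apply: measurable_funD => //; apply: measurable_funM; first exact: measurable_cst.
by apply: measurable_indic; exact: borel_open.
Qed.

Lemma step_function_bounded g : step_function g -> exists K, forall x, `|g x| <= K.
Proof.
elim=> {g} [|g c D sg [K bg] _]; first by exists 0 => x; rewrite normr0.
exists (K + `|c|) => x; apply: le_trans (ler_normD _ _) _; apply: lerD => //.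
rewrite normrM ler_piMr // indicE; case: (_ \in _); rewrite ?normr1 ?normr0 //.
Qed.

(** The list [s] does not depend on the measure, so convergence of masses of compact open sets gives
    convergence of the integrals of [g]. *)
Lemma step_function_integral g : step_function g ->
  exists s : seq (R * set X), (forall c, c \in s -> is_compact_open c.2) /\
  forall P : radon_probability R X,
    Rintegral (measure_of P) setT g = \sum_(c <- s) c.1 * mass c.2 P.
Proof.
elim=> {g} [|g c D sg [s [cs sE]] cD].
  exists [::]; split=> // P; rewrite big_nil Rintegral_cst //; exact: mul0r.
exists ((c, D) :: s); split=> [d|P].
  by rewrite in_cons => /orP[/eqP ->|/cs].
have mD : measurable (D : set (borel X)) by apply: borel_open; have [] := cD.
have [K bg] := step_function_bounded sg.
have bi (x : X) : `|\1_D x : R| <= 1.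
  by rewrite indicE; case: (_ \in _); rewrite ?normr1 ?normr0.
have mi : measurable_fun setT (\1_D : borel X -> R) by exact: measurable_indic.
have inti := bounded_integrable (measure_of P) mi bi.
have intg := bounded_integrable (measure_of P) (step_function_measurable sg) bg.
rewrite big_cons /= -sE addrC RintegralD //; last first.
  apply: (@bounded_integrable _ _ _ _ `|c|) => [|x].
    exact: measurable_funM.
  by rewrite normrM ler_piMr.
by rewrite RintegralZl // Rintegral_indic.
Qed.

Lemma tight_compact M : tight M -> compact (closure M).
Proof.
move=> tM; have tclM := tight_closure tM.
rewrite compact_ultra => U UU UM.
(* Masses stay in the compact interval from 0 to 1, so they converge along the ultrafilter; sets
   that are not compact open get the value 0. *)
have exm C : exists r : R, [/\ 0 <= r, r <= 1 & is_compact_open C ->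
    mass C mu @[mu --> U] --> r].
  have [cC|nC] := pselect (is_compact_open C); last by exists 0; split.
  have mC : measurable (C : set (borel X)) by apply: borel_open; have [] := cC.
  have uU : UltraFilter (mass C @ U).
    apply: ultra_of_dichotomy => A; exact: (in_ultra_setVsetC (mass C @^-1` A) UU).
  have U01 : U (mass C @^-1` [set` `[0, 1]]).
    apply: filterS UM => nu _; rewrite /= in_itv /=; apply/andP.
    by split; [exact: mass_ge0|exact: mass_le1].
  have := @segment_compact R 0 1; rewrite compact_ultra => /(_ _ uU U01)[r []].
  by rewrite /= in_itv => /andP[r0 r1] cr; exists r; split.
have [m mP] := choice exm.
have mcv C : is_compact_open C -> mass C mu @[mu --> U] --> m C by have [_ _] := mP C.
have mm C : is_compact_open C -> measurable (C : set (borel X)).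
  by move=> [_ oC]; exact: borel_open.
have [|||e e0|mu muE] := @content_extension R X hX bX m.
- by move=> C; have [] := mP C.
- move=> A B cA cB AB; have cAB := mcv _ (compact_openU cA cB).
  apply: (cvg_unique (@Rhausdorff R) cAB).
  rewrite (_ : mass (A `|` B) = fun nu => mass A nu + mass B nu).
    by apply: cvgD; exact: mcv.
  by apply/funext => nu; rewrite massU //; exact: mm.
- by move=> C; have [] := mP C.
- have [C cC clC] := tclM e e0; exists C => //.
  rewrite -(cvg_lim (@Rhausdorff R) (mcv C cC)).
  apply: limr_ge; first by apply/cvg_ex; exists (m C); exact: mcv.
  by apply: filterS UM => nu; exact: clC.
suff cU : U --> (mu : prob_space R X).
  exists (mu : prob_space R X); split=> //.
  apply: closed_closure => V /cU UV; exact: filter_ex (filterI UM UV).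
have mumass C : is_compact_open C -> mass C mu = m C.
  by move=> cC; rewrite /mass muE.
apply: prob_space_cvg => -[f fP]; rewrite /integral_against /=.
have [cf [K0 [_ bf0]]] := fP.
pose K := `|K0| + 1.
have bf x : `|f x| <= K.
  by apply: bf0 => //; rewrite (le_lt_trans (ler_norm _)) // ltrDl.
have K_gt0 : 0 < K by rewrite ltr_pwDr.
apply/cvgrPdist_lt => e e0.
(* With these [e1] and [d], replacing [f] by [g] costs at most [e1 + e1 = e / 4] for each of the two
   measures, and the integrals of [g] will differ by less than [e / 4]. *)
pose e1 := e / 8; have e1_gt0 : 0 < e1 by rewrite divr_gt0.
pose d := e1 / (K + e1 + (K + e1)).
have Ke_gt0 : 0 < K + e1 + (K + e1) by have := addr_gt0 K_gt0 e1_gt0; lra.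
have d_gt0 : 0 < d by apply: divr_gt0.
have [C cC clC] := tclM d d_gt0.
have muC : 1 - d <= mass C mu.
  rewrite mumass // -(cvg_lim (@Rhausdorff R) (mcv C cC)).
  apply: limr_ge; first by apply/cvg_ex; exists (m C); exact: mcv.
  by apply: filterS UM => nu; exact: clC.
have [W [g [CW sg Wg nWg]]] := step_function_approx cf cC.1 e1_gt0.
have bg x : `|g x| <= K + e1.
  have [Wx|nWx] := pselect (W x); last by rewrite nWg // normr0 ltW // addr_gt0.
  have -> : g x = f x - (f x - g x) by ring.
  by apply: le_trans (ler_normB _ _) _; apply: lerD => //; exact: Wg.
have close (nu : radon_probability R X) : 1 - d <= mass C nu ->
    `|Rintegral (measure_of nu) setT f - Rintegral (measure_of nu) setT g| <= e1 + e1.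
  move=> nuC; have -> : e1 + e1 = e1 + (K + e1 + (K + e1)) * d.
    by rewrite /d mulrC divfK // gt_eqF.
  apply: Rintegral_close (mm C cC) _ _ => //.
  - exact: continuous_borel_measurable.
  - exact: step_function_measurable.
  - by move=> x; rewrite (le_trans (bf x)) // lerDl ltW.
  - exact: ltW.
  - rewrite massE; last by apply: measurableC; exact: mm.
    by rewrite lee_fin mass_setC; [lra|exact: mm].
  - by move=> x /CW; exact: Wg.
have [s [cs sE]] := step_function_integral sg.
have cg : Rintegral (measure_of nu) setT g @[nu --> U] --> Rintegral (measure_of mu) setT g.
  rewrite sE (_ : (fun _ => _) = fun nu => \sum_(c <- s) c.1 * mass c.2 nu); last first.
    by apply/funext => nu; rewrite sE.
  elim: s cs {sE} => [|c s IH] cs.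
    by rewrite big_nil; under eq_fun do rewrite big_nil; exact: cvg_cst.
  rewrite big_cons; under eq_fun do rewrite big_cons.
  apply: cvgD; last by apply: IH => c' c's; apply: cs; rewrite in_cons c's orbT.
  have cc := cs c (mem_head _ _).
  by apply: cvgM; [exact: cvg_cst|rewrite mumass //; exact: mcv].
have e4 : 0 < e / 4 by rewrite divr_gt0.
move/cvgrPdist_lt : cg => /(_ _ e4) cg.
apply: filterS2 UM cg => nu clnu close_g.
have c1 := close mu muC; have c2 := close nu (clC nu clnu).
have e1E : e1 + e1 = e / 4 by rewrite /e1; lra.
rewrite e1E in c1 c2.
set If := Rintegral (measure_of mu) setT f in c1 *.
set Ig := Rintegral (measure_of mu) setT g in c1 close_g.
set Jf := Rintegral (measure_of nu) setT f in c2 *.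
set Jg := Rintegral (measure_of nu) setT g in c2 close_g.
have -> : If - Jf = (If - Ig) + (Ig - Jg) + (Jg - Jf) by ring.
rewrite distrC in c2.
apply: le_lt_trans (ler_normD _ _) _; apply: le_lt_trans (lerD (ler_normD _ _) (lexx _)) _.
lra.
Qed.

End tightness.

(** * The gliding hump *)

Definition from (m : nat) : set nat := [set k | (m <= k)%N].

Section gliding_hump.
Context (R : realType) (p : beta_omega).
Hypothesis op : omega_star p.
(** [T n A] stands for the mass that the [n]-th measure puts on the principal points of [A]. *)
Variable T : nat -> set nat -> R.
Hypothesis T_ge0 : forall n A, 0 <= T n A.
Hypothesis TU : forall n A B, A `&` B = set0 -> T n (A `|` B) = T n A + T n B.
Hypothesis T_le1 : forall n A, T n A <= 1.
Hypothesis T_tail : forall n e, 0 < e -> exists m, T n (from m) <= e.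

Let T_le n A B : A `<=` B -> T n A <= T n B.
Proof.
move=> AB; rewrite -(setDUK AB) TU ?lerDl //.
by rewrite setDIK.
Qed.

Let T_tail_le n e m m' : (m <= m')%N -> T n (from m) <= e -> T n (from m') <= e.
Proof. by move=> mm'; apply: le_trans; apply: T_le => k; exact: leq_trans. Qed.

Let head n m := T n `I_m.

Let head_le n m m' : (m <= m')%N -> head n m <= head n m'.
Proof. by move=> mm'; apply: T_le => k /= /leq_trans; apply. Qed.

Let T_between n m m' : (m <= m')%N ->
  T n [set k | (m <= k < m')%N] = head n m' - head n m.
Proof.
move=> mm'; rewrite /head.
have -> : `I_m' = `I_m `|` [set k | (m <= k < m')%N].
  apply/seteqP; split=> k /=.
    by move=> km'; have [km|mk] := ltnP k m; [left|right].
  by move=> [km|/andP[//]]; exact: leq_trans mm'.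
rewrite TU; first by rewrite addrAC subrr add0r.
by apply/seteqP; split=> // k [/= km /andP[mk _]]; move: km; rewrite ltnNge mk.
Qed.

Let T0 n : T n set0 = 0.
Proof. by have := TU n (setI0 set0); rewrite setU0 => H; lra. Qed.

Let pF := proj1_sig p.

Let pFU : UltraFilter pF.
Proof. exact: proj2_sig. Qed.

Let pFP : ProperFilter pF.
Proof. have FU := pFU; exact: ultra_proper. Qed.

Let lim_head m : exists l : R, (fun n => head n m) @ pF --> l.
Proof.
have FP := pFP; have uU : UltraFilter ((fun n => head n m) @ pF).
  apply: ultra_of_dichotomy => A; exact: (in_ultra_setVsetC _ pFU).
have U01 : pF ((fun n => head n m) @^-1` [set` `[0, 1]]).
  apply: filterS filterT => n _; rewrite /= in_itv /=; apply/andP.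
  by split; [exact: T_ge0|exact: T_le1].
have := @segment_compact R 0 1; rewrite compact_ultra => /(_ _ uU U01)[r [_ cr]].
by exists r.
Qed.

(* For [n] on a set of [p], [head n] is close to its limit [s] along [p] on any
   initial segment, and [s] is Cauchy.  Alternating this with the choice of
   small tails yields [n_j] and consecutive blocks such that the mass of [n_j]
   outside the [j]-th block has a uniformly small tail; the even or the odd
   blocks are outside [p]. *)
Lemma gliding_hump : exists s : nat -> nat, (forall i j, (i < j)%N -> (s i < s j)%N) /\
  exists2 A, stone_set A p & forall e, 0 < e ->
    exists m, forall j, T (s j) (A `&` from m) <= e.
Proof.
have FP := pFP; have [s sP] := choice lim_head.
have s_le m m' : (m <= m')%N -> s m <= s m'.
  move=> mm'; rewrite -(cvg_lim (@Rhausdorff R) (sP m)) -(cvg_lim (@Rhausdorff R) (sP m')).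
  apply: ler_lim; [by apply/cvg_ex; exists (s m)|by apply/cvg_ex; exists (s m')|].
  by apply: filterS filterT => n _; exact: head_le.
have s_le1 m : s m <= 1.
  rewrite -(cvg_lim (@Rhausdorff R) (sP m)); apply: limr_le.
    by apply/cvg_ex; exists (s m).
  by apply: filterS filterT => n _; exact: T_le1.
have s_cauchy e : 0 < e -> exists m0, forall m m', (m0 <= m)%N -> (m <= m')%N -> s m' - s m <= e.
  move=> e0; have cs : cvgn s by apply: nondecreasing_is_cvgn => //; exists 1 => _ [m _ <-].
  have /cvgrPdist_le/(_ _ e0)[m0 _ m0P] := cs.
  exists m0 => m m' mm mm'; have := m0P m mm; rewrite /= ler_norml => /andP[_].
  have := nondecreasing_cvgn_le s_le cs m'; lra.
pose d (j : nat) : R := j.+1%:R^-1.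
have d_gt0 j : 0 < d j by rewrite invr_gt0 ltr0n.
have [tl tlP] : exists tl : nat * nat -> nat, forall x, T x.1 (from (tl x)) <= d x.2.
  have [tl tlP] := choice (fun x : nat * nat => T_tail x.1 (d_gt0 x.2)).
  by exists tl.
have near_head (x : nat * nat * nat) : exists n', (x.1.2 < n')%N /\
    forall m, (m <= x.1.1)%N -> `|s m - head n' m| <= d x.2.
  move: x => [[k n] j] /=.
  have H1 : pF (from n.+1).
    have [//|nfrom] := in_ultra_setVsetC (from n.+1) pFU.
    exfalso; apply: (omega_star_finite op (_ : finite_set `I_n.+1)) => //.
    apply: stone_setS (nfrom : stone_set _ p) => i /=.
    by rewrite /from /= => /negP; rewrite -ltnNge.
  have H2 : pF [set n' | forall m, (m <= k)%N -> `|s m - head n' m| <= d j].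
    elim: k => [|k IH].
      have /cvgrPdist_le/(_ _ (d_gt0 j)) := sP 0%N.
      by apply: filterS => n' /= Hn m; rewrite leqn0 => /eqP ->.
    have /cvgrPdist_le/(_ _ (d_gt0 j)) := sP k.+1.
    apply: filterS2 IH => n' Hk Hn m; rewrite leq_eqVlt => /orP[/eqP ->//|].
    by rewrite ltnS; exact: Hk.
  have [n' [nn' Hn']] := filter_ex (filterI H1 H2).
  by exists n'.
have [nx nxP] := choice near_head.
(* [st j] is the pair [(n_j, k_j)]: first [k_(j+1)] is taken where the tail of [n_j] is small, then
   [n_(j+1)] with a head close to [s] up to [k_(j+1)]. *)
pose st := fix st j := if j is j'.+1 then
    let k' := maxn (tl ((st j').1, j')) (st j').2.+1 in
    (nx (k', (st j').1, j), k')
  else (0%N, 0%N).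
pose n_ j := (st j).1; pose k_ j := (st j).2.
have kS j : (k_ j < k_ j.+1)%N by rewrite /k_ /= leq_max leqnn orbT.
have nS j : (n_ j < n_ j.+1)%N.
  by rewrite /n_ /=; set x := (_, _, _); have [] := nxP x.
have close j m : (m <= k_ j)%N -> `|s m - head (n_ j) m| <= d j.
  case: j => [|j] mk; last first.
    by move: mk; rewrite /n_ /k_ /=; set x := (_, _, _) => mk; have [_] := nxP x; apply.
  move: mk; rewrite /k_ /= leqn0 => /eqP ->.
  have hE n : head n 0 = 0 by rewrite /head II0 T0.
  have -> : s 0%N = 0.
    rewrite -(cvg_lim (@Rhausdorff R) (sP 0%N)); under eq_fun do rewrite hE.
    by apply: lim_cst; exact: Rhausdorff.
  by rewrite hE subrr normr0 ltW.
have tailj j : T (n_ j) (from (k_ j.+1)) <= d j.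
  apply: T_tail_le (tlP (n_ j, j)); rewrite /k_ /=; exact: leq_maxl.
have k_ge j : (j <= k_ j)%N.
  by elim: j => // j IH; exact: leq_ltn_trans (kS j).
have k_mono i j : (i <= j)%N -> (k_ i <= k_ j)%N.
  by move=> ij; apply: (homo_leq (r := leq)) ij => //; [exact: leq_trans|move=> l; exact: ltnW].
pose blocks b := [set m | exists j, odd j = b /\ (k_ j <= m < k_ j.+1)%N].
have cover : blocks true `|` blocks false = setT.
  apply/seteqP; split=> // m _.
  have exj : exists j, (m < k_ j)%N by exists m.+1; exact: k_ge.
  case: (ex_minnP exj) => -[|j] mj minj; first by rewrite ltn0 in mj.
  have kj : (k_ j <= m)%N.
    by rewrite leqNgt; apply/negP => /minj; rewrite ltnn.
  by case oj : (odd j); [left|right]; exists j; rewrite oj kj mj.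
have [c pc] : exists c, stone_set (blocks c) p.
  have : stone_set (blocks true `|` blocks false) p by rewrite cover stone_setT.
  by rewrite stone_setU => -[]; [exists true|exists false].
(* The indices of the parity opposite to [c]: the block numbered [t j], where the mass of [n_ (t j)]
   is not controlled, is disjoint from [blocks c]. *)
pose t j := (j.*2 + ~~ c)%N.
have odd_t j : odd (t j) = ~~ c by rewrite /t oddD odd_double oddb.
have nt j : (n_ (t j) < n_ (t j.+1))%N.
  rewrite /t doubleS !addSn; exact: ltn_trans (nS _) (nS _).
exists (n_ \o t); split.
  by move=> i j; apply: (@homo_ltn _ (n_ \o t) (fun a b => a < b)%N) => //; exact: ltn_trans.
exists (blocks c) => // e e0.
have e4 : 0 < e / 4 by rewrite divr_gt0.
have [m0 m0P] := s_cauchy _ e4.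
have [j0 j0P] : exists j0, forall j, (j0 <= j)%N -> d j <= e / 4.
  have /cvgrPdist_le/(_ _ e4)[j0 _ H] := @cvg_harmonic R.
  exists j0 => j jj; have := H j jj; rewrite /= sub0r normrN /harmonic.
  by rewrite ger0_norm // ltW // d_gt0.
(* The finitely many [j] for which [d j] is not yet small are treated one by one. *)
have [M MP] : exists M, forall j, (j < j0)%N -> T (n_ (t j)) (from M) <= e.
  elim: j0 {j0P} => [|j0 [M MP]]; first by exists 0%N.
  have [M' M'P] := T_tail (n_ (t j0)) e0.
  exists (maxn M M') => j; rewrite ltnS leq_eqVlt => /orP[/eqP ->|/MP].
    by apply: T_tail_le M'P; exact: leq_maxr.
  by apply: T_tail_le; exact: leq_maxl.
exists (maxn m0 M) => j /=; set m := maxn m0 M.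
have [jj0|j0j] := ltnP j j0.
  apply: le_trans (MP j jj0); apply: T_le => k [_] /=; apply: leq_trans.
  exact: leq_maxr.
have tj : (j <= t j)%N by rewrite /t -addnn -addnA leq_addr.
have dj := j0P _ (leq_trans j0j tj).
pose kj := maxn m (k_ (t j)).
have mkj : (m <= kj)%N by exact: leq_maxl.
have tl_le := tailj (t j).
have sub : blocks c `&` from m `<=` [set k | (m <= k < k_ (t j))%N] `|` from (k_ (t j).+1).
  move=> k [[l [ol /andP[kl lk]]] mk].
  have [kk|kk] := ltnP k (k_ (t j)); first by left; apply/andP.
  right; rewrite /from /= leqNgt; apply/negP => kk'.
  have lt : l != t j.
    by apply/eqP => lt; have := odd_t j; rewrite -lt ol; case: (c).
  move: lt; rewrite neq_ltn => /orP[lt|lt].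
    by have := leq_trans lk (k_mono _ _ lt); rewrite ltnNge kk.
  by have := leq_trans kk' (k_mono _ _ lt); rewrite ltnNge kl.
apply: le_trans (T_le _ sub) _.
rewrite TU; last first.
  apply/seteqP; split=> // k [/= /andP[_ k1] k2]; have := leq_trans (ltnW (kS _)) k2.
  by rewrite leqNgt k1.
have [mk|km] := leqP m (k_ (t j)); last first.
  rewrite (_ : [set _ | _] = set0) ?T0 ?add0r; first by lra.
  apply/seteqP; split=> // k /= /andP[mk kt].
  by have := ltn_trans (leq_ltn_trans mk kt) km; rewrite ltnn.
(* The mass between [m] and [k_ (t j)] is at most the increase of [s] plus two errors [d (t j)],
   that is [3e / 4]; the tail adds at most [e / 4]. *)
rewrite T_between //.
have := close _ _ (leqnn (k_ (t j))); have := close (t j) m mk.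
rewrite !ler_norml => /andP[a1 a2] /andP[b1 b2].
have := m0P m _ (leq_maxl _ _) mk.
lra.
Qed.

End gliding_hump.

(** * Measures on punctured subspaces of [beta_omega] *)

Section mass_lemmas.
Context (R : realType) (X : ptopologicalType).
Implicit Types (mu : radon_probability R X) (A B : set (borel X)).

Lemma le_mass mu A B : measurable A -> measurable B -> A `<=` B ->
  mass A mu <= mass B mu.
Proof.
move=> mA mB AB; rewrite -lee_fin -!massE //.
by apply: le_measure => //; exact/mem_set.
Qed.

Lemma mass_subadd mu A B : measurable A -> measurable B ->
  mass (A `|` B) mu <= mass A mu + mass B mu.
Proof.
move=> mA mB; rewrite -lee_fin EFinD -!massE //; last exact: measurableU.
exact: (@measureU2 _ _ _ (measure_of mu)).
Qed.

Lemma mass_set0 mu : mass set0 mu = 0.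
Proof. by rewrite /mass measure0. Qed.

(** At most [n+1] disjoint sets can have mass above [1/(n+1)]. *)
Lemma countable_positive_mass mu (I : choiceType) (D : set I) (F : I -> set (borel X)) :
  (forall j, measurable (F j)) -> (forall j, D j -> 0 < mass (F j) mu) ->
  (forall j k, D j -> D k -> j <> k -> F j `&` F k = set0) -> countable D.
Proof.
move=> mF D0 dF.
pose Dn n := [set j | D j /\ n.+1%:R^-1 < mass (F j) mu].
rewrite (_ : D = \bigcup_n Dn n); last first.
  apply/seteqP; split=> [j Dj|j [n _ []//]].
  have [n _ /(_ n (leqnn _)) nF] := near_infty_natSinv_lt (PosNum (D0 j Dj)).
  by exists n.
apply: bigcup_countable => // n _; apply: finite_set_countable.
apply: contrapT => /(@infinite_set_fset _ _ n.+2)[S SD].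
have mS (s : seq I) : measurable (\bigcup_(j in [set` s]) F j).
  by apply: fin_bigcup_measurable.
have sum (s : seq I) : uniq s -> (forall j, j \in s -> Dn n j) ->
    (size s)%:R * n.+1%:R^-1 <= mass (\bigcup_(j in [set` s]) F j) mu.
  elim: s => [_ _|j s IH /= /andP[js us] sD]; first by rewrite mul0r mass_ge0.
  have -> : \bigcup_(k in [set` j :: s]) F k = F j `|` \bigcup_(k in [set` s]) F k.
    apply/seteqP; split=> x.
      move=> [k /=]; rewrite in_cons => /orP[/eqP ->|ks] Fk; [by left|by right; exists k].
    move=> [Fj|[k ks Fk]]; first by exists j => //=; exact: mem_head.
    by exists k => //=; rewrite in_cons (ks : k \in s) orbT.
  have Dj := sD j (mem_head _ _).
  have sD' k : k \in s -> Dn n k by move=> ks; apply: sD; rewrite in_cons ks orbT.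
  rewrite massU //; last first.
    apply/seteqP; split=> // x [Fj [k ks Fk]].
    have jk : j <> k by move=> jk; move: js; rewrite jk (ks : k \in s).
    by rewrite -(dF j k Dj.1 (sD' k ks).1 jk).
  by rewrite -add1n natrD mulrDl mul1r lerD ?IH // ltW // Dj.2.
move=> nS; have := le_trans (sum _ (fset_uniq S) SD) (mass_le1 _ (mS _)).
rewrite ler_pdivrMr // mul1r ler_nat => le.
by have := leq_trans nS le; rewrite ltnn.
Qed.

End mass_lemmas.

Lemma countable_enum (T : choiceType) (M : set T) (x0 : T) : countable M ->
  exists e : nat -> T, M `<=` range e.
Proof.
move=> /countable_injP[f finj]; exists (fun n => xget x0 [set x | M x /\ f x = n]) => x Mx.
exists (f x) => //; case: xgetP => [y _ [My fy]|/(_ x)]; last by case.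
by apply: finj => //; exact/mem_set.
Qed.

(** * Both punctured spaces at once, through the inclusion [i] into [beta_omega] *)

Section punctured.
Context (R : realType) (X : ptopologicalType) (p : beta_omega) (i : X -> beta_omega).
Hypothesis hX : hausdorff_space X.
Hypothesis ip : forall x, i x <> p.
Hypothesis nbhs_i : forall x V,
  nbhs x V <-> exists2 A, stone_set A (i x) & i @^-1` stone_set A `<=` V.
Hypothesis compact_i : forall A, ~ stone_set A p -> compact (i @^-1` stone_set A).
Hypothesis okp : ok_point p.
Implicit Types (mu : radon_probability R X).

Let pre (A : set nat) : set X := i @^-1` stone_set A.

Lemma open_pre A : open (pre A).
Proof. by rewrite openE => x xA; apply/nbhs_i; exists A. Qed.

Lemma measurable_pre A : measurable (pre A : set (borel X)).
Proof. exact: borel_open (open_pre A). Qed.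

Lemma compact_open_pre A : ~ stone_set A p -> is_compact_open (pre A).
Proof. by move=> pA; split; [exact: compact_i|exact: open_pre]. Qed.

Lemma punctured_base : compact_open_base X.
Proof.
move=> x V /nbhs_i[A xA AV].
have [B xB pB] : exists2 B, stone_set B (i x) & ~ stone_set B p.
  apply: contrapT => H; apply: (ip (x := x)); apply: beta_omega_eq => B xB.
  by apply: contrapT => pB; apply: H; exists B.
exists (pre (A `&` B)); split.
- by apply: compact_open_pre; rewrite stone_setI => -[].
- by rewrite /pre /= stone_setI.
- by move=> y; rewrite /pre /= stone_setI => -[yA _]; exact: AV.
Qed.

Let W : set X := i @^-1` omega_star.

Lemma closed_W : closed W.
Proof.
rewrite -[W]setCK; apply: open_closedC; rewrite openE => x /= /contrapT[n _ nx].
apply/nbhs_i; exists [set n]; first by rewrite stone_set1 nx.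
by move=> y; rewrite /pre /= stone_set1 /W /= => ->; apply; exists n.
Qed.

Let mW : measurable (W : set (borel X)).
Proof. exact (borel_closed closed_W). Qed.

Let mpreW A : measurable (pre A `&` W : set (borel X)).
Proof. exact: measurableI (measurable_pre A) mW. Qed.

(** The topological support of the restriction of [mu] to the nonprincipal part [W]. *)
Definition support mu : set X :=
  W `&` [set x | forall A, stone_set A (i x) -> 0 < mass (pre A `&` W) mu].

Lemma closed_support mu : closed (support mu).
Proof.
apply: closedI; first exact: closed_W.
rewrite -[X in closed X]setCK; apply: open_closedC; rewrite openE => x /=.
move=> /existsNP[A /not_implyP[xA nA]]; apply/nbhs_i; exists A => // y yA yP.
by apply: nA; exact: yP.
Qed.

Let mS mu : measurable (support mu : set (borel X)).
Proof. exact (borel_closed (closed_support (mu := mu))). Qed.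

(** This is where the Radon property enters: a compact subset of [W] off the support is covered by
    finitely many basic sets that are null on [W]. *)
Lemma support_full mu : mass (W `\` support mu) mu = 0.
Proof.
have mWS : measurable (W `\` support mu : set (borel X)) by exact: measurableD.
apply/eqP; rewrite eq_le mass_ge0 andbT; apply/ler_addgt0Pr => e e0; rewrite add0r.
have [rad _] : radon (measure_of mu) /\ forall A, ~ measurable A -> measure_of mu A = 0%E.
  exact: set_mem (svalP mu).
have [K [cK KW Ke]] := rad _ mWS e e0.
pose Q V := exists2 A, V `<=` pre A & mass (pre A `&` W) mu = 0.
have [|U V [A UA A0] [B VB B0]|x Kx|V KV [A VA A0]] := @compact_ind _ K Q cK.
- by exists set0 => //; rewrite /pre stone_set0 preimage_set0 set0I mass_set0.
- exists (A `|` B); first by rewrite /pre stone_setU preimage_setU; exact: setUSS.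
  rewrite /pre stone_setU preimage_setU setIUl; apply/eqP; rewrite eq_le mass_ge0 andbT.
  by apply: le_trans (mass_subadd _ (mpreW A) (mpreW B)) _; rewrite A0 B0 addr0.
- have [Wx /not_andP[//|/existsNP[A /not_implyP[xA nA]]]] := KW x Kx.
  exists (pre A); first by split=> //; exact: open_pre.
  exists A => //; apply/eqP; rewrite eq_le mass_ge0 andbT leNgt; exact/negP.
have KAW : K `<=` pre A `&` W.
  by move=> x Kx; split; [exact/VA/KV|have [] := KW x Kx].
have cKm : measurable (K : set (borel X)) by apply: borel_closed; exact: compact_closed.
have mKD : measurable (W `\` support mu `\` K : set (borel X)) by exact: measurableD.
rewrite -[W `\` support mu](setDUK KW).
apply: le_trans (mass_subadd _ cKm mKD) _.
have -> : mass K mu = 0.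
  by apply/eqP; rewrite eq_le mass_ge0 andbT -A0 le_mass.
by rewrite add0r ltW // -lte_fin -massE.
Qed.

Lemma mass_support mu A : measurable (A : set (borel X)) ->
  mass (A `&` W) mu = mass (A `&` support mu) mu.
Proof.
move=> mA; have mAW : measurable (A `&` W : set (borel X)) by exact: measurableI.
have mAS : measurable (A `&` support mu : set (borel X)) by exact: measurableI.
have mWS : measurable (W `\` support mu : set (borel X)) by exact: measurableD.
apply/eqP; rewrite eq_le; apply/andP; split; last first.
  by apply: le_mass => // x [Ax [Wx _]].
apply: (@le_trans _ _ (mass ((A `&` support mu) `|` (W `\` support mu)) mu)).
  apply: le_mass => //; first exact: measurableU.
  by move=> x [Ax Wx]; have [Sx|nSx] := pselect (support mu x); [left|right].
by apply: le_trans (mass_subadd _ mAS mWS) _; rewrite support_full addr0.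
Qed.

Lemma supports_ccc (mu : nat -> radon_probability R X) :
  ccc_on (i @` \bigcup_n support (mu n)).
Proof.
move=> I D O OM dO.
rewrite (_ : D = \bigcup_n [set j | D j /\ 0 < mass (pre (O j) `&` W) (mu n)]); last first.
  apply/seteqP; split=> [j Dj|j [n _ []//]].
  have [_ [[x [n _ Sx] <-] xO]] := OM j Dj.
  by exists n => //; split=> //; have [_ /(_ _ xO)] := Sx.
apply: bigcup_countable => // n _.
(* The [O j] are disjoint only on the supports, hence the intersection, which loses no mass of
   [W]. *)
apply: (@countable_positive_mass _ _ (mu n) _ _ (fun j => pre (O j) `&` support (mu n))).
- by move=> j; apply: measurableI => //; exact: measurable_pre.
- by move=> j [_]; rewrite mass_support //; exact: measurable_pre.
- move=> j k [Dj _] [Dk _] jk; apply/seteqP; split=> // x [[xj Sx] [xk _]].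
  by apply: (dO j k Dj Dk jk (i x)) => //; exists x => //; exists n.
Qed.

(** The OK point is separated from the union of the supports, so one neighbourhood of [p] serves for
    the whole sequence. *)
Lemma common_null (mu : nat -> radon_probability R X) :
  exists2 A, stone_set A p & forall n, mass (pre A `&` W) (mu n) = 0.
Proof.
have [||A pA MA] := @ok_point_ccc p (i @` \bigcup_n support (mu n)) okp _ _ (@supports_ccc mu).
- by move=> _ [x [n _ [Wx _]] <-].
- by move=> [x _ /ip].
exists A => // n; rewrite mass_support; last exact: measurable_pre.
rewrite (_ : _ `&` _ = set0) ?mass_set0 //; apply/seteqP; split=> // x [xA Sx].
by apply: (MA (i x)) => //; exists x => //; exists n.
Qed.

Lemma pre_setC A : pre (~` A) = ~` pre A.
Proof. by rewrite /pre stone_setC preimage_setC. Qed.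

Lemma concentrated (mu : nat -> radon_probability R X) : W = setT ->
  exists2 C, is_compact_open C & forall n, mass C (mu n) = 1.
Proof.
move=> WT; have [A pA A0] := common_null mu.
exists (pre (~` A)); first by apply: compact_open_pre; rewrite stone_setC; apply.
move=> n; rewrite pre_setC mass_setC; last exact: measurable_pre.
by have := A0 n; rewrite WT setIT => ->; rewrite subr0.
Qed.

Lemma punctured_beta mu : W = setT ->
  exists K : set X, compact K /\ measure_of mu K = 1%E.
Proof.
move=> /(concentrated (fun=> mu))[C [cC oC] C1]; exists C; split=> //.
by rewrite massE ?(C1 0%N) //; exact (borel_open oC).
Qed.

Lemma punctured_omega_bounded : W = setT -> omega_bounded (prob_space R X).
Proof.
move=> WT M cM; apply: (@tight_compact _ _ hX punctured_base).
have [->|/set0P[mu0 M0]] := eqVneq M set0.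
  by move=> e _; exists set0 => //; exact: compact_open0.
have [mu Mmu] := countable_enum mu0 cM.
have [C cC C1] := concentrated mu WT.
move=> e e0; exists C => // _ /Mmu[n _ <-].
by rewrite C1; lra.
Qed.

Let atoms (A : set nat) : set X := i @^-1` (principal @` A).

Lemma open_atoms A : open (atoms A).
Proof.
rewrite openE => x [n An nx]; apply/nbhs_i; exists [set n].
  by rewrite stone_set1 nx.
by move=> y; rewrite stone_set1 => /= yn; exists n.
Qed.

Let matoms A : measurable (atoms A : set (borel X)).
Proof. exact (borel_open (open_atoms A)). Qed.

Lemma atoms_tail mu (e : R) : 0 < e -> exists m, mass (atoms (from m)) mu <= e.
Proof.
move=> e0; pose F m : set (borel X) := atoms (from m).
have F0 : \bigcap_m F m = set0.
  apply/seteqP; split=> // x Fx; have [n _ nx] := Fx 0%N I.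
  have [m] := Fx n.+1 I; rewrite /from /= -nx => nm /principal_inj mn.
  by move: nm; rewrite mn /from /= ltnn.
have cF : measure_of mu (F n) @[n --> \oo] --> measure_of mu (\bigcap_m F m).
  apply: nonincreasing_cvg_mu.
  - apply: le_lt_trans (ltry 1); exact: (@probability_le1 _ _ _ (measure_of mu) _ (matoms _)).
  - by move=> n; exact: matoms.
  - by rewrite F0; exact: measurable0.
  - apply/nonincreasing_seqP => n; apply/subsetPset => x [k /= nk kx].
    by exists k => //; exact: ltnW.
rewrite F0 measure0 in cF.
have cm : mass (F n) mu @[n --> \oo] --> (0 : R) by apply: fine_cvg cF.
have /cvgrPdist_le/(_ _ e0)[m _ H] := cm; exists m.
have := H m (leqnn m); rewrite /= sub0r normrN ger0_norm //; exact: mass_ge0.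
Qed.

Lemma punctured_totally_countably_compact : omega_star p ->
  totally_countably_compact (prob_space R X).
Proof.
move=> op L /infiniteP/card_leP[h].
pose f n : radon_probability R X := set_val (h (SigSub (mem_set (I : [set: nat] n)))).
have finj : injective f.
  move=> a b /val_inj hab.
  have /(congr1 set_val) // := @inj _ _ _ h _ _ (in_setT _) (in_setT _) hab.
have fL n : L (f n) by exact: set_mem (svalP (h _)).
have [A0 pA0 A00] := common_null f.
(* The nonprincipal mass near [p] is removed by [A0]; the gliding hump deals with the mass on
   [nat]. *)
have [|||| s [s_mono [A pA AP]]] := @gliding_hump R p op (fun n A => mass (atoms A) (f n)).
- by move=> n A; exact: mass_ge0.
- move=> n A B AB; rewrite -massU //; first by rewrite /atoms image_setU preimage_setU.
  apply/seteqP; split=> // x [[a Aa ax] [b Bb]]; rewrite -ax => /principal_inj ba.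
  have : (A `&` B) a by split; rewrite // -ba.
  by rewrite AB.
- by move=> n A; exact: mass_le1.
- by move=> n e; exact: atoms_tail.
exists (range (f \o s)); split.
- by move=> _ [j _ <-]; exact: fL.
- have sinj : injective (f \o s).
    move=> a b /finj sab; case: (ltngtP a b) => // /s_mono; by rewrite sab ltnn.
  rewrite (eq_finite_set (inj_card_eq (in2W sinj))); exact: infinite_nat.
- exact: card_image_le.
apply: (@tight_compact _ _ hX punctured_base) => e e0.
have [m mP] := AP e e0.
(* A neighbourhood of [p] whose principal part lies in the tail of [A] and whose nonprincipal part
   is null, so its complement carries mass at least [1 - e]. *)
pose B := A `&` A0 `&` from m.
have pB : stone_set B p.
  rewrite !stone_setI; split; first by split.
  have := stone_setTE p; rewrite -(setvU (from m)) stone_setU => -[pm|//].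
  exfalso; apply: (omega_star_finite op _ pm).
  by apply: sub_finite_set (finite_II m) => k; rewrite /from /= => /negP; rewrite -ltnNge.
exists (pre (~` B)); first by apply: compact_open_pre; rewrite stone_setC; apply.
move=> _ [j _ <-] /=; rewrite pre_setC mass_setC; last exact: measurable_pre.
rewrite lerD2l lerN2; apply: le_trans (mP j).
have mA0W : measurable (pre A0 `&` W : set (borel X)) by exact: mpreW.
apply: (@le_trans _ _ (mass (atoms (A `&` from m) `|` (pre A0 `&` W)) (f (s j)))).
  apply: le_mass; [exact: measurable_pre|exact: measurableU|].
  move=> x; rewrite /pre /= !stone_setI => -[[xA xA0] xm].
  have [Wx|/contrapT[k _ kx]] := pselect (W x); [by right|left].
  exists k => //; apply/stone_set_principal; rewrite kx stone_setI; by split.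
apply: le_trans (mass_subadd _ _ _) _ => //.
by rewrite A00 addr0.
Qed.

End punctured.

(** * Transfer to the subspaces [omega_star_minus] and [beta_omega_minus] *)

Section subtype.
Context (Q : set beta_omega).

Lemma nbhs_set_type (x : set_type Q) (V : set (set_type Q)) :
  nbhs x V <-> exists2 A, stone_set A (set_val x) & set_val @^-1` stone_set A `<=` V.
Proof.
split=> [|[A xA AV]].
  rewrite nbhsE => -[_ [[U oU <-] Ux] UV].
  have /nbhs_beta_omegaP[A xA AU] : nbhs (set_val x) U by exact: open_nbhs_nbhs.
  by exists A => // y yA; apply: UV; exact: AU.
apply: filterS AV _; apply: (@initial_continuous _ _ set_val).
by apply: open_nbhs_nbhs; split=> //; exact: open_stone_set.
Qed.

Lemma compact_set_type (K : set beta_omega) : compact K -> K `<=` Q ->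
  compact (set_val @^-1` K : set (set_type Q)).
Proof.
rewrite !compact_ultra => cK KQ F FU FK.
have FP : ProperFilter F by exact: ultra_proper.
have uF : UltraFilter (set_val @ F).
  apply: ultra_of_dichotomy => A; exact: (in_ultra_setVsetC (set_val @^-1` A) FU).
have [q [Kq Fq]] := cK _ uF FK.
pose x : set_type Q := SigSub (mem_set (KQ q Kq)).
exists x; split=> // V /nbhs_set_type[A xA AV]; apply: filterS AV _.
by apply: Fq; apply: open_nbhs_nbhs; split=> //; exact: open_stone_set.
Qed.

(** The traces of the [O j] on [M] are open, disjoint and nonempty, so distinct indices have
    distinct traces. *)
Lemma set_type_suslin_ccc (M : set (set_type Q)) :
  countable_suslin (set_type M) -> ccc_on (set_val @` M).
Proof.
move=> sM I D O OM dO.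
pose U j : set (set_type M) := [set y | stone_set (O j) (set_val (set_val y))].
have oU j : open (U j).
  exists (set_val @^-1` stone_set (O j)) => //.
  by exists (stone_set (O j)) => //; exact: open_stone_set.
have disj j k y : D j -> D k -> U j y -> U k y -> j = k.
  move=> Dj Dk yj yk; apply: contrapT => jk; apply: (dO j k Dj Dk jk _ _ yj yk).
  by exists (set_val y) => //; exact: set_mem (svalP y).
have U0 j : D j -> exists y, U j y.
  move=> Dj; have [_ [[z Mz <-] zO]] := OM j Dj.
  by exists (SigSub (mem_set Mz)).
have Uinj : {in D &, injective U}.
  move=> j k /set_mem Dj /set_mem Dk Ujk; have [y yj] := U0 j Dj.
  by apply: (disj j k y) => //; rewrite -Ujk.
rewrite -(eq_countable (inj_card_eq Uinj)); apply: sM => [_ [j _ <-]//|].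
move=> _ _ [j Dj <-] [k Dk <-] [y [yj yk]].
by rewrite (disj j k y).
Qed.

End subtype.

Lemma closed_stone_set A : closed (stone_set A).
Proof. by rewrite -[A]setCK stone_setC; apply: open_closedC; exact: open_stone_set. Qed.

Lemma closed_omega_star : closed omega_star.
Proof.
apply: open_closedC; rewrite openE => _ [n _ <-].
apply: filterS (open_nbhs_nbhs (conj (open_principal n) (erefl : [set principal n] _))).
by move=> _ ->; exists n.
Qed.

(** For [Q] a closed set minus the point [p]: on a [stone_set A] that misses [p], the puncture is
    invisible. *)
Lemma compact_stone_trace (Q C : set beta_omega) A : closed C ->
  Q `&` stone_set A = C `&` stone_set A ->
  compact (set_val @^-1` stone_set A : set (set_type Q)).
Proof.
move=> cC QC.
have -> : (set_val @^-1` stone_set A : set (set_type Q)) = set_val @^-1` (Q `&` stone_set A).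
  by apply/seteqP; split=> [x xA|x [//]]; split=> //; exact: set_mem (svalP x).
apply: compact_set_type; last by move=> x [].
apply: (@subclosed_compact _ _ setT _ beta_omega_compact) => //.
by rewrite QC; apply: closedI => //; exact: closed_stone_set.
Qed.

Lemma compact_omega_star_minus p A : ~ stone_set A p ->
  compact (set_val @^-1` stone_set A : set (omega_star_minus p)).
Proof.
move=> pA; apply: (@compact_stone_trace _ omega_star); first exact: closed_omega_star.
apply/seteqP; split=> x; first by move=> [[ox _] xA].
by move=> [ox xA]; split=> //; split=> // xp; apply: pA; rewrite -xp.
Qed.

Lemma compact_beta_omega_minus p A : ~ stone_set A p ->
  compact (set_val @^-1` stone_set A : set (beta_omega_minus p)).
Proof.
move=> pA; apply: (@compact_stone_trace _ setT); first exact: closedT.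
apply/seteqP; split=> x [_ xA]; first by split.
by split=> // xp; apply: pA; rewrite -xp.
Qed.

Lemma omega_star_minus_ccc_bounded p : ok_point p -> ccc_bounded (omega_star_minus p).
Proof.
move=> okp M /set_type_suslin_ccc cM.
have [||A pA MA] := ok_point_ccc okp _ _ cM.
- by move=> _ [x _ <-]; have [] := set_mem (svalP x).
- by move=> [x _ xp]; have [_] := set_mem (svalP x); apply.
have nA : ~ stone_set (~` A) p by rewrite stone_setC; apply.
have cA := compact_omega_star_minus nA.
apply: (subclosed_compact _ cA); first exact: closed_closure.
pose C : set (omega_star_minus p) := set_val @^-1` stone_set (~` A).
have -> : set_val @^-1` stone_set (~` A) = closure C.
  by apply/closure_id; apply: compact_closed cA; exact: omega_star_minus_hausdorff.
apply: closure_subset => x Mx; rewrite /C /= stone_setC; apply: MA; by exists x.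
Qed.

Local Close Scope ring_scope.

Theorem proposition4p9 (R : realType) :
  exists p : beta_omega, omega_star p /\
    [/\ ccc_bounded (omega_star_minus p),
        omega_bounded (prob_space R (omega_star_minus p)) /\
          [set: prob_space R (omega_star_minus p)] = prob_space_beta R (omega_star_minus p)
      & totally_countably_compact (prob_space R (beta_omega_minus p))].
Proof.
have [p op okp] := ok_point_exists.
have ip (x : omega_star_minus p) : set_val x <> p.
  by have [_] := set_mem (svalP x).
have ip' (x : beta_omega_minus p) : set_val x <> p.
  exact: set_mem (svalP x).
have WT : (set_val : omega_star_minus p -> beta_omega) @^-1` omega_star = setT.
  by apply/seteqP; split=> // x _; have [] := set_mem (svalP x).
have hX := @omega_star_minus_hausdorff p.
have cX := @compact_omega_star_minus p.
exists p; split=> //; split; first exact: omega_star_minus_ccc_bounded.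
  split; first exact: (punctured_omega_bounded hX ip (@nbhs_set_type _) cX okp WT).
  apply/seteqP; split=> // mu _.
  exact: (punctured_beta hX ip (@nbhs_set_type _) cX okp mu WT).
exact: (punctured_totally_countably_compact (@beta_omega_minus_hausdorff p) ip'
  (@nbhs_set_type _) (@compact_beta_omega_minus p) okp op).
Qed.
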